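(* Let $f$ be a holomorphic endomorphism of $\mathbb{CP}^k$ of degree $d \geq 2$ and let $\nu$ be an $f$-invariant ergodic Borel probability measure on $\mathbb{CP}^k$, with metric entropy $h_\nu$ and largest Lyapunov exponent $\lambda_1$. 1. If $\log d^{k-1} < h_\nu$, then $\lambda_1 \geq (1 - 1/k) \log \sqrt d$. 2. If $\log d^{k-1} < h_\nu < (1 + 1/k) \log d^{k-1}$, then $\lambda_1 \geq \frac12 (h_\nu - \log d^{k-1}) + \varphi(h_\nu)$, where $\varphi(h_\nu) := \frac12 \left[ (1+1/k) \log d^{k-1} - h_\nu \right] > 0$.
   Context: A holomorphic endomorphism $f$ of $\mathbb{CP}^k$ of degree $d$ is a map given in homogeneous coordinates by $[P_0:\cdots:P_k]$, where the $P_i$ are homogeneous polynomials of degree $d$ with no common zero except the origin. The Lyapunov exponents $\lambda_k \leq \cdots \leq \lambda_1$ of $\nu$ are the $k$ exponents of the complex differential of $f$, counted with complex multiplicity. *)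

(* Defs.v *)
From HB Require Import structures.
From mathcomp Require Import all_boot all_order all_algebra.
From mathcomp Require Import complex.
From mathcomp Require mpoly.

Set Implicit Arguments.
Unset Strict Implicit.
Unset Printing Implicit Defensive.

(* The notations of mpoly clash with those of MathComp-Analysis, so mpoly is
   imported only inside this module. *)
Module PolyLift.
Import mpoly GRing.Theory.
Local Open Scope ring_scope.

Record endo (C : numClosedFieldType) (k d : nat) := Endo {
  endo_coord : 'I_k.+1 -> {mpoly C[k.+1]};
  endo_coord_homog : forall i, endo_coord i \is d.-homog;
  endo_coord_nondeg : forall z : 'rV[C]_k.+1,
    (forall i, (endo_coord i).@[z ord0] = 0) -> z = 0 }.

Definition endo_lift (C : numClosedFieldType) (k d : nat) (f : endo C k d)
  (z : 'rV[C]_k.+1) : 'rV[C]_k.+1 := \row_i (endo_coord f i).@[z ord0].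

Lemma endo_lift_neq0 (C : numClosedFieldType) (k d : nat) (f : endo C k d)
  (z : 'rV[C]_k.+1) : z != 0 -> endo_lift f z != 0.
Proof.
apply: contra_neq => fz0; apply: (endo_coord_nondeg (e := f)) => i.
by move/rowP: fz0 => /(_ i); rewrite !mxE.
Qed.

End PolyLift.

From mathcomp Require Import all_classical all_reals all_analysis.
Export PolyLift.

Import Order.TTheory GRing.Theory Num.Theory.
Import numFieldNormedType.Exports.

Local Open Scope classical_set_scope.
Local Open Scope ring_scope.
Local Open Scope complex_scope.
Local Open Scope quotient_scope.

(* R[i] under the structure from which its topology is inferred. *)
Definition cplx (R : realType) : numClosedFieldType := R[i].

Section ProjectiveSpace.
Variables (R : realType) (k : nat).
Local Notation C := (cplx R).

Definition nzvec : Type := [set z : 'rV[C]_k.+1 | z != 0].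
HB.instance Definition _ := Topological.on nzvec.
HB.instance Definition _ := Choice.on nzvec.

Definition nzval (z : nzvec) : 'rV[C]_k.+1 := set_val z.

Definition mk_nzvec (z : 'rV[C]_k.+1) (z0 : z != 0) : nzvec :=
  exist _ z (mem_set z0).

Definition proportional (z w : nzvec) : bool :=
  `[< exists2 c : C, c != 0 & nzval w = c *: nzval z >].

Lemma proportional_refl : reflexive proportional.
Proof. by move=> z; apply/asboolP; exists 1; rewrite ?oner_neq0 ?scale1r. Qed.

Lemma proportional_sym : symmetric proportional.
Proof.
suff imp z w : proportional z w -> proportional w z.
  by move=> z w; apply/idP/idP; exact: imp.
move=> /asboolP[c c0 wE]; apply/asboolP; exists c^-1; first by rewrite invr_eq0.
by rewrite wE scalerA mulVf// scale1r.
Qed.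

Lemma proportional_trans : transitive proportional.
Proof.
move=> w z v /asboolP[c c0 wE] /asboolP[b b0 vE]; apply/asboolP.
by exists (b * c); rewrite ?mulf_neq0// vE wE scalerA.
Qed.

Definition proportional_equiv :=
  EquivRel proportional proportional_refl proportional_sym proportional_trans.

Definition CP : Type := quotient_topology {eq_quot proportional_equiv}.
HB.instance Definition _ := Quotient.on CP.
HB.instance Definition _ := Topological.on CP.
HB.instance Definition _ := Choice.on CP.

Definition proj_class (z : nzvec) : CP := \pi_CP z.

Definition hcoord (x : CP) : 'rV[C]_k.+1 := nzval (repr x).

Lemma hcoord_neq0 (x : CP) : hcoord x != 0.
Proof. exact: set_mem (svalP (repr x)). Qed.

Lemma const1_neq0 : const_mx 1 != 0 :> 'rV[C]_k.+1.
Proof. by apply/eqP => /rowP/(_ ord0)/eqP; rewrite !mxE oner_eq0. Qed.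

HB.instance Definition _ := isPointed.Build CP (proj_class (mk_nzvec const1_neq0)).

(* The measurable sets of CP are the Borel sets. *)
HB.instance Definition _ :=
  Measurable.copy CP (g_sigma_algebraType (@open CP)).

Definition endo_map (d : nat) (f : endo C k d) (x : CP) : CP :=
  proj_class (mk_nzvec (endo_lift_neq0 f (hcoord_neq0 x))).

End ProjectiveSpace.

Section Dynamics.
Context (disp : measure_display) (T : measurableType disp) (R : realType).
Variables (mu : probability T R) (f : T -> T).

Definition invariant_measure : Prop :=
  forall A : set T, measurable A -> mu (f @^-1` A) = mu A.

Definition ergodic_measure : Prop :=
  forall A : set T, measurable A -> f @^-1` A = A ->
    mu A = 0%E \/ mu A = 1%E.

Definition finite_partition (m : nat) (A : 'I_m -> set T) : Prop :=
  [/\ forall i, measurable (A i), trivIset setT A & \bigcup_i A i = setT].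

(* The atoms of A \/ f^-1 A \/ ... \/ f^-(n-1) A. *)
Definition join_atom (m : nat) (A : 'I_m -> set T) (n : nat)
    (w : {ffun 'I_n -> 'I_m}) : set T :=
  \bigcap_(j in [set: 'I_n]) (iter j f @^-1` A (w j)).

(* Empty atoms contribute 0, in accordance with 0 ln 0 = 0. *)
Definition join_entropy (m : nat) (A : 'I_m -> set T) (n : nat) : R :=
  - \sum_(w : {ffun 'I_n -> 'I_m})
      fine (mu (join_atom A w)) * ln (fine (mu (join_atom A w))).

Definition partition_entropy (m : nat) (A : 'I_m -> set T) : R :=
  limn (fun n => join_entropy A n / n%:R).

Definition metric_entropy : \bar R :=
  ereal_sup [set h | exists (m : nat) (A : 'I_m -> set T),
    finite_partition A /\ h = (partition_entropy A)%:E].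

End Dynamics.

Section Lyapunov.
Variables (R : realType) (k : nat).
Local Notation C := (cplx R).

Definition hermitian_norm (z : 'rV[C]_k.+1) : R :=
  Num.sqrt (complex.Re (spectral.dotmx z z)).

(* Let pi be the projection C^(k+1) \ {0} -> CP^k.  Its differential at z is
   onto with kernel C z, so that the tangent space of CP^k at pi z is
   C^(k+1) / C z.  This is the Fubini-Study norm of the tangent vector
   d_z pi (w): the norm of the component of w orthogonal to z, divided by that
   of z. *)
Definition fubini_study_norm (z w : 'rV[C]_k.+1) : R :=
  hermitian_norm
    (w - (spectral.dotmx w z / spectral.dotmx z z) *: z) / hermitian_norm z.

(* Since f^n o pi = pi o F^n for the polynomial lift F of f, the differential
   of f^n at pi z sends d_z pi (w) to d_{F^n z} pi (d_z F^n (w)).  This is the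
   Fubini-Study norm of this image. *)
Definition diff_iter_norm (d : nat) (f : endo C k d) (n : nat)
    (z w : 'rV[C]_k.+1) : R :=
  fubini_study_norm (iter n (endo_lift f) z) ('d (iter n (endo_lift f)) z w).

(* lam lists the exponents given by Oseledets' theorem in nonincreasing order
   (lambda_(i+1) is lam i), each repeated according to its complex
   multiplicity: at almost every x there is a complete flag
   T_x CP^k = W_0 > W_1 > ... > W_k = 0 of complex subspaces such that every
   vector of W_i \ W_(i+1) has exponent lam i.  V i is the preimage of W_i in
   C^(k+1).  Exponents may be -oo, as f may have critical points. *)
Definition lyapunov_exponents (d : nat) (f : endo C k d)
    (nu : probability (CP R k) R) (lam : 'I_k -> \bar R) : Prop :=
  (forall i j : 'I_k, (i <= j)%N -> (lam j <= lam i)%E) /\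
  {ae nu, forall x : CP R k, exists V : nat -> {vspace 'rV[C]_k.+1},
    [/\ forall i, (i <= k)%N -> \dim (V i) = (k.+1 - i)%N,
        forall i, (i < k)%N -> (V i.+1 <= V i)%VS,
        V k = <[hcoord x]>%VS &
        forall (i : 'I_k) (w : 'rV[C]_k.+1), w \in V i -> w \notin V i.+1 ->
          (fun n : nat =>
             (n%:R^-1)%:E * lne (diff_iter_norm f n (hcoord x) w)%:E)%E
            @ \oo --> lam i]}.

End Lyapunov.

(* Main.v *)
Require Import Defs.
From HB Require Import structures.
From mathcomp Require Import all_boot all_order all_algebra.
From mathcomp Require Import complex.
From mathcomp Require Import all_classical all_reals all_analysis.
From mathcomp Require mpoly.
From mathcomp Require Import ring lra zify.
Import Order.TTheory GRing.Theory Num.Theory.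
Import numFieldNormedType.Exports.
Local Open Scope classical_set_scope.
Local Open Scope ring_scope.

(** The second part of the theorem is the first one in disguise: the terms in
   h of h/2 - L/2 + phi(h) cancel, and L/(2k) = (1 - 1/k) log sqrt d remains.
   The first part follows from the inequality of Ruelle in the weak form
   h <= 2 k max(lambda_1, 0): if lambda_1 < t = (1 - 1/k) log sqrt d, then
   h <= 2 k t = log d^(k-1).

   The inequality is proved by counting (partition_entropy_le).  Projective
   space is cut into grid cells of mesh 1/q, described in affine charts by k
   complex coordinates of modulus at most 1.  If some point y of a cell
   satisfies |D_y f^n| <= e^(nt), then for large q the image of the cell under
   g = f^n has chordal diameter of order e^(nt)/q (iter_lift_expansion), hence
   meets at most C e^(2knt) cells (card_close_cells), with C independent of n
   and q.  Almost every point satisfies this bound for all large n (stretch_ae),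
   so that the cells without such a point y have total measure tending to 0; on
   these cells g expands the chordal distance by a factor at most M^n
   (iter_lift_lipschitz), which bounds the number of cells by C M^(2kn).

   Entropy enters only through the inequality of Gibbs: the entropy of a finite
   partition is at most the mean length of any code for it.  The name of a
   point of length nN with respect to a partition A is coded by the successive
   cells of x, g x, ..., g^(N-1) x, each cell being chosen uniformly among those
   that the image of the previous cell meets (entropy_block).  When q is large,
   the cell of x determines the name of length n of x outside a set of small
   measure (cells_approximate_map), and on this set the name is written down in
   full.  Dividing by nN and letting N, then n, tend to infinity gives the
   inequality. *)

Set Implicit Arguments.
Unset Strict Implicit.
Unset Printing Implicit Defensive.

(** * Entropy of finite-valued maps *)

Section FiniteValued.
Context (disp : measure_display) (T : measurableType disp) (R : realType).
Variable mu : probability T R.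

Definition fibers_measurable (I : finType) (X : T -> I) : Prop :=
  forall i, measurable (X @^-1` [set i]).

Definition law (I : finType) (X : T -> I) (i : I) : R :=
  fine (mu (X @^-1` [set i])).

Definition expect (I : finType) (X : T -> I) (phi : I -> R) : R :=
  \sum_i law X i * phi i.

Definition entropy (I : finType) (X : T -> I) : R :=
  - \sum_i law X i * ln (law X i).

Lemma law_ge0 (I : finType) (X : T -> I) i : 0 <= law X i.
Proof. exact: fine_ge0. Qed.

Lemma prob_fin_num (A : set T) : measurable A -> mu A \is a fin_num.
Proof. exact: fin_num_measure. Qed.

Lemma preimage_fibers (I : finType) (X : T -> I) (P : {pred I}) :
  X @^-1` [set i | P i] = \bigcup_(i in [set i | P i]) X @^-1` [set i].
Proof.
by apply/seteqP; split=> x /= => [Px|[i Pi ->//]]; exists (X x).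
Qed.

Lemma measurable_fibers (I : finType) (X : T -> I) (P : {pred I}) :
  fibers_measurable X -> measurable (X @^-1` [set i | P i]).
Proof.
move=> mX; rewrite preimage_fibers; exact: fin_bigcup_measurable.
Qed.

Lemma prob_preimage (I : finType) (X : T -> I) (P : {pred I}) :
  fibers_measurable X ->
  fine (mu (X @^-1` [set i | P i])) = \sum_(i | P i) law X i.
Proof.
move=> mX; rewrite preimage_fibers measure_fin_bigcup //; last 2 first.
- exact: finite_finset.
- apply/trivIsetP => i j _ _ /eqP ij; rewrite -subset0 => x /= [Xi Xj].
  by apply: ij; rewrite -Xi -Xj.
rewrite fsbig_finite//= -sum_fine; last first.
  by move=> i _; apply: prob_fin_num; exact: mX.
rewrite -[RHS]big_enum/=; apply: perm_big.
apply: uniq_perm; rewrite ?enum_uniq// ?finmap.fset_uniq// => i.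
rewrite in_fset_set//= mem_enum.
by apply/idP/idP => [|Pi]; rewrite inE.
Qed.

Lemma law_comp (I J : finType) (X : T -> I) (h : I -> J) j :
  fibers_measurable X ->
  law (h \o X) j = \sum_(i | h i == j) law X i.
Proof.
move=> mX; rewrite -prob_preimage// /law; congr (fine (mu _)).
by apply/seteqP; split => x /= /eqP.
Qed.

Lemma comp_fibers (I J : finType) (X : T -> I) (h : I -> J) :
  fibers_measurable X -> fibers_measurable (h \o X).
Proof.
move=> mX j; have := measurable_fibers [pred i | h i == j] mX.
by congr measurable; apply/seteqP; split => x /= /eqP.
Qed.

Lemma pair_fibers (I J : finType) (X : T -> I) (Y : T -> J) :
  fibers_measurable X -> fibers_measurable Y ->
  fibers_measurable (fun x => (X x, Y x)).
Proof.
move=> mX mY [i j]; have := measurableI _ _ (mX i) (mY j).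
by congr measurable; apply/seteqP; split => x /= [-> ->].
Qed.

Lemma expect_comp (I J : finType) (X : T -> I) (h : I -> J) (phi : J -> R) :
  fibers_measurable X -> expect (h \o X) phi = expect X (phi \o h).
Proof.
move=> mX; rewrite /expect [RHS](partition_big h xpredT)//=.
apply: eq_bigr => j _; rewrite law_comp// mulr_suml.
by apply: eq_bigr => i /eqP ->.
Qed.

Lemma law_sum1 (I : finType) (X : T -> I) :
  fibers_measurable X -> \sum_i law X i = 1.
Proof.
move=> mX; rewrite -(prob_preimage xpredT)//.
rewrite (_ : _ @^-1` _ = setT) ?probability_setT//.
by apply/seteqP; split.
Qed.

Lemma law_gt0 (I : finType) (X : T -> I) i :
  0 < law X i -> exists x, X x = i.
Proof.
move=> p0; apply/not_existsP => nX; move: p0; rewrite /law.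
rewrite (_ : _ @^-1` _ = set0) ?measure0 ?ltxx//.
by apply/seteqP; split => // x /= Xi; exact: nX Xi.
Qed.

Lemma expect_le (I : finType) (X : T -> I) (phi psi : I -> R) :
  (forall x, phi (X x) <= psi (X x)) -> expect X phi <= expect X psi.
Proof.
move=> le_phi; apply: ler_sum => i _.
have := law_ge0 X i; rewrite le_eqVlt => /predU1P[<-|p0]; first by rewrite !mul0r.
by rewrite ler_pM2l//; have [x <-] := law_gt0 p0.
Qed.

Lemma expectD (I : finType) (X : T -> I) (phi psi : I -> R) :
  expect X (fun i => phi i + psi i) = expect X phi + expect X psi.
Proof. by rewrite -big_split/=; apply: eq_bigr => i _; rewrite mulrDr. Qed.

Lemma expect_cst (I : finType) (X : T -> I) (c : R) :
  fibers_measurable X -> expect X (fun=> c) = c.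
Proof. by move=> mX; rewrite /expect -mulr_suml law_sum1// mul1r. Qed.

Lemma expectZ (I : finType) (X : T -> I) (c : R) (phi : I -> R) :
  expect X (fun i => c * phi i) = c * expect X phi.
Proof. by rewrite /expect mulr_sumr; apply: eq_bigr => i _; rewrite mulrCA. Qed.

Lemma expect_indicator (I : finType) (X : T -> I) (P : {pred I}) :
  fibers_measurable X ->
  expect X (fun i => (P i)%:R) = fine (mu (X @^-1` [set i | P i])).
Proof.
move=> mX; rewrite prob_preimage// [RHS]big_mkcond/=.
by apply: eq_bigr => i _; case: (P i); rewrite ?mulr1 ?mulr0.
Qed.

(** This is ln x <= x - 1, summed against the law of X.  As q only has to be a
   subprobability, every code for the values of X bounds its entropy. *)
Lemma gibbs (I : finType) (X : T -> I) (q : I -> R) :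
  fibers_measurable X -> (forall i, 0 <= q i) -> \sum_i q i <= 1 ->
  (forall i, 0 < law X i -> 0 < q i) ->
  entropy X <= expect X (fun i => - ln (q i)).
Proof.
move=> mX q0 q1 qpos; rewrite -subr_ge0 /entropy /expect opprK -big_split/=.
rewrite -(@lerD2r _ (\sum_i q i - 1)) add0r.
apply: (@le_trans _ _ 0); first by rewrite subr_le0.
rewrite -(law_sum1 mX) -sumrB -big_split/=; apply: sumr_ge0 => i _.
have := law_ge0 X i; rewrite le_eqVlt => /predU1P[<-|p0].
  by rewrite !mul0r !add0r subr0.
have qi0 := qpos _ p0.
have : ln (q i / law X i) <= q i / law X i - 1.
  have := @le_ln1Dx R (q i / law X i - 1).
  by rewrite (addrC 1) subrK; apply; rewrite ltrBrDl subrr divr_gt0.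
rewrite ln_div ?posrE// => le_ln.
rewrite -(ler_pM2l p0) in le_ln.
have e : law X i * (q i / law X i - 1) = q i - law X i.
  by rewrite mulrBr mulr1 mulrCA divff ?mulr1 ?gt_eqF.
rewrite e in le_ln; lra.
Qed.

Lemma entropy_comp (I J : finType) (X : T -> I) (h : I -> J) :
  fibers_measurable X -> entropy (h \o X) <= entropy X.
Proof.
move=> mX; have mhX := comp_fibers h mX.
rewrite /entropy lerN2.
rewrite -[leRHS]/(expect (h \o X) (fun j => ln (law (h \o X) j))) expect_comp//.
apply: ler_sum => i _ /=.
have := law_ge0 X i; rewrite le_eqVlt => /predU1P[<-|p0]; first by rewrite !mul0r.
have le_law : law X i <= law (h \o X) (h i).
  by rewrite law_comp// (bigD1 i)//= lerDl sumr_ge0// => j _; exact: law_ge0.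
by rewrite ler_pM2l// ler_ln// posrE// (lt_le_trans p0).
Qed.

(** The inequality of Gibbs for the subprobability law X i * Q i j: the
   logarithm splits the cost into that of X and that of Y given X. *)
Lemma entropy_pair (I J : finType) (X : T -> I) (Y : T -> J) (Q : I -> J -> R) :
  fibers_measurable X -> fibers_measurable Y ->
  (forall i j, 0 <= Q i j) -> (forall i, \sum_j Q i j <= 1) ->
  (forall x, 0 < Q (X x) (Y x)) ->
  entropy (fun x => (X x, Y x)) <=
    entropy X + expect (fun x => (X x, Y x)) (fun p => - ln (Q p.1 p.2)).
Proof.
move=> mX mY Q0 Q1 Qpos; have mXY := pair_fibers mX mY.
have lawX p : 0 < law (fun x => (X x, Y x)) p -> 0 < law X p.1.
  move=> p0; have -> : X = fst \o (fun x => (X x, Y x)) by [].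
  rewrite law_comp// (bigD1 p)//= ltr_pwDl// sumr_ge0// => j _.
  exact: law_ge0.
apply: (@le_trans _ _ (expect (fun x => (X x, Y x))
    (fun p => - ln (law X p.1 * Q p.1 p.2)))).
  apply: gibbs => //.
  - by move=> p; rewrite mulr_ge0 ?law_ge0.
  - rewrite -(pair_bigA _ (fun i j => law X i * Q i j))/=.
    rewrite -(law_sum1 mX); apply: ler_sum => i _.
    by rewrite -mulr_sumr ler_piMr ?law_ge0.
  - move=> p p0; rewrite mulr_gt0 ?lawX//.
    by have [x px] := law_gt0 p0; rewrite -px; exact: Qpos.
have -> : entropy X =
    expect (fun x => (X x, Y x)) (fun p => - ln (law X p.1)).
  rewrite -(@expect_comp _ _ _ fst (fun i => - ln (law X i)))//.
  by rewrite /entropy /expect -sumrN; apply: eq_bigr => i _; rewrite mulrN.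
rewrite -expectD; apply: ler_sum => p _.
have := law_ge0 (fun x => (X x, Y x)) p.
rewrite le_eqVlt => /predU1P[<-|p0]; first by rewrite !mul0r.
rewrite lnM ?posrE ?lawX// ?opprD//.
by have [x px] := law_gt0 p0; rewrite -px; exact: Qpos.
Qed.

Lemma entropy_le_card (I : finType) (X : T -> I) :
  fibers_measurable X -> entropy X <= ln #|I|%:R.
Proof.
move=> mX; case: (pickP (xpredT : pred I)) => [i0 _|I0]; last first.
  rewrite /entropy big_pred0// (eq_card0 I0) oppr0.
  by have := law_sum1 mX; rewrite big_pred0// => /eqP; rewrite eq_sym oner_eq0.
have I0 : 0 < #|I|%:R :> R by rewrite ltr0n; apply/card_gt0P; exists i0.
rewrite (@le_trans _ _ (expect X (fun=> - ln (#|I|%:R^-1))))//.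
  apply: gibbs => //.
  - by rewrite sumr_const -[leLHS]mulr_natl divff// gt_eqF.
  - by move=> _ _; rewrite invr_gt0.
by rewrite expect_cst// lnV ?posrE// opprK.
Qed.

Section Words.
Variable g : T -> T.
Hypothesis g_meas : measurable_fun setT g.
Hypothesis g_inv : invariant_measure mu g.

Lemma iter_fibers (I : finType) (X : T -> I) n :
  fibers_measurable X -> fibers_measurable (X \o iter n g).
Proof.
move=> mX; elim: n => [//|n IHn] i.
have := g_meas measurableT (IHn i); rewrite setTI.
by congr measurable; apply/seteqP; split => x /=; rewrite -iterSr.
Qed.

Lemma law_iter (I : finType) (X : T -> I) n :
  fibers_measurable X -> law (X \o iter n g) = law X.
Proof.
move=> mX; elim: n => [//|n IHn]; rewrite -IHn; apply/funext => i.
rewrite /law -[in RHS]g_inv; last exact: iter_fibers.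
by congr (fine (mu _)); apply/seteqP; split => x /=; rewrite -iterSr.
Qed.

Definition word (I : finType) (X : T -> I) (n : nat) (x : T) : {ffun 'I_n -> I} :=
  [ffun j : 'I_n => X (iter j g x)].

Lemma word_fibers (I : finType) (X : T -> I) n :
  fibers_measurable X -> fibers_measurable (word X n).
Proof.
move=> mX w.
have -> : word X n @^-1` [set w] =
    \bigcap_(j in [set: 'I_n]) ((X \o iter j g) @^-1` [set w j]).
  apply/seteqP; split => [x /= <- j _|x /= wx]; first by rewrite /= ffunE.
  by apply/ffunP => j; rewrite ffunE; exact: wx.
by apply: fin_bigcap_measurable => // j _; exact: iter_fibers.
Qed.

(** Each new letter is coded from the previous one by the kernel Q; by invariance
   its mean cost does not depend on its position. *)
Lemma entropy_word (Z : finType) (zeta : T -> Z) (Q : Z -> Z -> R) N :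
  fibers_measurable zeta ->
  (forall z z', 0 <= Q z z') -> (forall z, \sum_z' Q z z' <= 1) ->
  (forall x, 0 < Q (zeta x) (zeta (g x))) ->
  entropy (word zeta N.+1) <= ln #|Z|%:R +
    N%:R * expect (fun x => (zeta x, zeta (g x))) (fun p => - ln (Q p.1 p.2)).
Proof.
move=> mz Q0 Q1 Qpos.
have mzg : fibers_measurable (fun x => (zeta x, zeta (g x))).
  by apply: pair_fibers => //; exact: (@iter_fibers _ _ 1).
elim: N => [|N IHN].
  rewrite mul0r addr0; pose h z : {ffun 'I_1 -> Z} := [ffun _ => z].
  have -> : word zeta 1 = h \o zeta.
    by apply/funext => x; apply/ffunP => j; rewrite !ffunE (ord1 j).
  by rewrite (le_trans (entropy_comp _ mz))// entropy_le_card.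
pose X := word zeta N.+1; pose Y := zeta \o iter N.+1 g.
have mX : fibers_measurable X by exact: word_fibers.
have mY : fibers_measurable Y by exact: iter_fibers.
pose h (p : {ffun 'I_N.+1 -> Z} * Z) : {ffun 'I_N.+2 -> Z} :=
  [ffun j => oapp p.1 p.2 (unlift ord_max j)].
have -> : word zeta N.+2 = h \o (fun x => (X x, Y x)).
  apply/funext => x; apply/ffunP => j; rewrite !ffunE/=.
  case: unliftP => [i ->|->] //=; rewrite ffunE/= /bump.
  by rewrite leqNgt ltn_ord add0n.
apply: (le_trans (entropy_comp _ (pair_fibers mX mY))).
apply: (le_trans (@entropy_pair _ _ X Y (fun w z => Q (w ord_max) z) mX mY _ _ _)).
- by move=> *; exact: Q0.
- by move=> *; exact: Q1.
- by move=> x; rewrite /X /Y ffunE/=; exact: Qpos.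
rewrite -natr1 mulrDl mul1r addrA lerD//.
pose h' (p : {ffun 'I_N.+1 -> Z} * Z) : Z * Z := (p.1 ord_max, p.2).
rewrite -(@expect_comp _ _ _ h' (fun p => - ln (Q p.1 p.2)));
  last exact: pair_fibers.
have -> : h' \o (fun x => (X x, Y x)) =
    (fun x => (zeta x, zeta (g x))) \o iter N g.
  by apply/funext => x; rewrite /h' /X /Y /= ffunE.
by rewrite /expect law_iter.
Qed.

End Words.

End FiniteValued.

(** * Approximation of Borel partitions by small cells *)

Section Approximation.
Context (disp : measure_display) (T : measurableType disp) (R : realType).
Variable mu : probability T R.

Lemma vanishing_prob (F : nat -> set T) (eta : R) :
  (forall n, measurable (F n)) -> (forall n m, (n <= m)%N -> F m `<=` F n) ->
  mu (\bigcap_n F n) = 0%E -> 0 < eta ->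
  exists N, forall n, (N <= n)%N -> (mu (F n) < eta%:E)%E.
Proof.
move=> mF decF F0 eta0.
have : mu \o F @ \oo --> mu (\bigcap_n F n).
  apply: nonincreasing_cvg_mu => //.
  - by rewrite (le_lt_trans (probability_le1 mu (mF 0%N)))// ltry.
  - exact: bigcapT_measurable.
  - by move=> n m /decF nm; exact/subsetPset.
rewrite F0 => /fine_cvgP[_ /cvgrPdist_lt/(_ _ eta0)[N _ FN]].
exists N => n Nn; have := FN n Nn; rewrite /= sub0r normrN ger0_norm ?fine_ge0//.
by rewrite -lte_fin fineK// prob_fin_num.
Qed.

Variables (K : nat -> finType) (beta : forall q, T -> K q).
Hypothesis beta_meas : forall q, fibers_measurable (beta q).

(** Up to a small error set, which depends on the family of cells, every cell lies
   in S or in its complement.  This form of approximation is symmetric in S and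
   its complement. *)
Definition cellwise_approx (S : set T) : Prop :=
  measurable S /\ forall eta : R, 0 < eta -> exists q0, forall q, (q0 <= q)%N ->
    exists E : set T, [/\ measurable E, (mu E < eta%:E)%E &
      forall x y, beta q x = beta q y -> ~ E x -> ~ E y -> S x -> S y].

Lemma cellwise_approx0 : cellwise_approx set0.
Proof.
split=> // eta eta0; exists 0%N => q _; exists set0.
by split => //; rewrite measure0 lte_fin.
Qed.

Lemma cellwise_approxC (S : set T) :
  cellwise_approx S -> cellwise_approx (~` S).
Proof.
move=> [mS aS]; split; first exact: measurableC.
move=> eta /aS[q0 q0P]; exists q0 => q /q0P[E [mE E_eta EP]].
exists E; split => // x y xy Ex Ey /= Sx Sy; apply: Sx; apply: EP Sy => //.
Qed.

Lemma cellwise_approxU (S1 S2 : set T) :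
  cellwise_approx S1 -> cellwise_approx S2 -> cellwise_approx (S1 `|` S2).
Proof.
move=> [mS1 aS1] [mS2 aS2]; split; first exact: measurableU.
move=> eta eta0; have eta2 : 0 < eta / 2 by rewrite divr_gt0.
have [q1 q1P] := aS1 _ eta2; have [q2 q2P] := aS2 _ eta2.
exists (maxn q1 q2) => q; rewrite geq_max => /andP[/q1P[E1 [mE1 lt1 P1]]].
move=> /q2P[E2 [mE2 lt2 P2]]; exists (E1 `|` E2); split.
- exact: measurableU.
- rewrite (le_lt_trans (measureU2 mu mE1 mE2))// [eta]splitr EFinD.
  by rewrite lteD.
- move=> x y xy /= /not_orP[n1x n2x] /not_orP[n1y n2y].
  by case=> [/P1|/P2] Sy; [left|right]; exact: Sy.
Qed.

(** A countable union differs from one of its finite subunions by a set of small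
   measure, which is added to the error. *)
Lemma cellwise_approx_sigma : sigma_algebra setT cellwise_approx.
Proof.
split; first exact: cellwise_approx0.
  by move=> A; rewrite setTD; exact: cellwise_approxC.
move=> A aA; have mA n : measurable (A n) by have [] := aA n.
pose P n := \big[setU/set0]_(j < n) A j.
have aP n : cellwise_approx (P n).
  rewrite /P; elim/big_ind: _ => //; first exact: cellwise_approx0.
  exact: cellwise_approxU.
split; first exact: bigcupT_measurable.
move=> eta eta0; have eta2 : 0 < eta / 2 by rewrite divr_gt0.
pose D n := (\bigcup_k A k) `\` P n.
have mD n : measurable (D n).
  apply: measurableD; first exact: bigcupT_measurable.
  by have [] := aP n.
have [n nP] : exists N, forall n, (N <= n)%N -> (mu (D n) < (eta / 2)%:E)%E.
  apply: vanishing_prob => //.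
    move=> n m nm; apply: setDS; rewrite /P -!bigcup_mkord.
    by move=> x [j /= jn Ajx]; exists j => //=; exact: leq_trans nm.
  rewrite (_ : \bigcap_n D n = set0) ?measure0//.
  rewrite -subset0 => x Dx; have [[k _ Akx] _] := Dx 0%N I.
  by have [_] := Dx k.+1 I; apply; rewrite /P -bigcup_mkord; exists k => /=.
have [q0 q0P] := (aP n).2 _ eta2.
exists q0 => q /q0P[E [mE ltE EP]]; exists (E `|` D n); split.
- exact: measurableU.
- rewrite (le_lt_trans (measureU2 mu mE (mD n)))// [eta]splitr EFinD.
  by rewrite lteD// nP.
- move=> x y xy /= /not_orP[Ex Dx] /not_orP[Ey Dy] Ax.
  have Pnx : P n x by apply: contrapT => nP'; apply: Dx.
  have := EP _ _ xy Ex Ey Pnx; rewrite /P -bigcup_mkord => -[j _ Ajy].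
  by exists j.
Qed.

(** Cells that eventually enter every neighbourhood of each of their points
   approximate open sets, hence all Borel sets.  For an open set U the error at
   time n is the set of the points of U one of whose cells of index at least n
   leaves U; it decreases to the empty set. *)
Lemma cells_approximate (G : set (set T)) :
  (forall U, G U -> measurable U) ->
  (forall U x, G U -> U x ->
    exists q0, forall q, (q0 <= q)%N -> forall y, beta q y = beta q x -> U y) ->
  <<s G >> `<=` cellwise_approx.
Proof.
move=> mG shrink; apply: smallest_sub; first exact: cellwise_approx_sigma.
move=> U GU; split; first exact: mG.
pose W q := [set x | forall y, beta q y = beta q x -> U y].
have mW q : measurable (W q).
  have -> : W q = beta q @^-1` [set i | `[< forall y, beta q y = i -> U y >]].
    by apply/seteqP; split => x /= => [Wx|/asboolP//]; exact/asboolP.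
  exact: measurable_fibers.
have mWn n : measurable (\bigcap_(q in [set q | (n <= q)%N]) W q).
  by apply: bigcap_measurableType.
pose D n := U `\` \bigcap_(q in [set q | (n <= q)%N]) W q.
move=> eta eta0.
have [n nP] : exists N, forall n, (N <= n)%N -> (mu (D n) < eta%:E)%E.
  apply: vanishing_prob => //.
  - by move=> n; apply: measurableD; [exact: mG|exact: mWn].
  - move=> n m nm; apply: setDS => x Wx q mq; apply: Wx.
    exact: leq_trans mq.
  - rewrite (_ : \bigcap_n D n = set0) ?measure0//.
    rewrite -subset0 => x Dx; have [Ux _] := Dx 0%N I.
    have [q0 q0P] := shrink _ _ GU Ux; have [_] := Dx q0 I; apply.
    by move=> q /= q0q y; exact: q0P.
exists n => q nq; exists (D n); split => //.
- by apply: measurableD; [exact: mG|exact: mWn].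
- exact: nP.
- move=> x y xy Dx _ Ux.
  have Wx : (\bigcap_(q in [set q | (n <= q)%N]) W q) x.
    by apply: contrapT => nW; apply: Dx.
  exact: (Wx q nq).
Qed.

(** The error sets of the finitely many fibers of X are united; outside this union
   the cell decides which fiber contains the point. *)
Lemma cells_approximate_map (G : set (set T)) (J : finType) (X : T -> J)
    (eta : R) :
  (forall U, G U -> measurable U) ->
  (forall U x, G U -> U x ->
    exists q0, forall q, (q0 <= q)%N -> forall y, beta q y = beta q x -> U y) ->
  (forall j, <<s G >> (X @^-1` [set j])) -> 0 < eta ->
  exists q0, forall q, (q0 <= q)%N -> exists E : set T,
    [/\ measurable E, (mu E < eta%:E)%E &
        forall x y, beta q x = beta q y -> ~ E x -> ~ E y -> X x = X y].
Proof.
move=> mG shrink GX eta0.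
have aX j := cells_approximate mG shrink (GX j).
pose delta := eta / (#|J|.+1)%:R.
have delta0 : 0 < delta by rewrite divr_gt0.
have /choice[q0 q0P] : forall j : J, exists q0, forall q, (q0 <= q)%N ->
    exists E : set T, [/\ measurable E, (mu E < delta%:E)%E &
      forall x y, beta q x = beta q y -> ~ E x -> ~ E y -> X x = j -> X y = j].
  by move=> j; exact: (aX j).2.
exists (\max_j q0 j)%N => q qP.
have /choice[E EP] : forall j : J, exists E : set T,
    [/\ measurable E, (mu E < delta%:E)%E &
      forall x y, beta q x = beta q y -> ~ E x -> ~ E y -> X x = j -> X y = j].
  by move=> j; apply: q0P; apply: leq_trans qP; exact: leq_bigmax.
exists (\big[setU/set0]_j E j); split.
- by apply: bigsetU_measurable => j _; have [] := EP j.
- apply: (@le_lt_trans _ _ (\sum_j mu (E j))%E).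
    have : measurable (\big[setU/set0]_j E j) /\
        (mu (\big[setU/set0]_j E j) <= \sum_j mu (E j))%E; last by case.
    elim/big_ind2: _ => [|A a B b [mA leA] [mB leB]|j _].
    + by rewrite measure0.
    + split; first exact: measurableU.
      by rewrite (le_trans (measureU2 mu mA mB))// leeD.
    + by have [] := EP j.
  apply: (@le_lt_trans _ _ (\sum_(j : J) delta%:E)%E).
    by apply: lee_sum => j _; have [_ /ltW] := EP j.
  rewrite sumEFin lte_fin sumr_const -mulr_natl /delta mulrCA.
  by rewrite -[ltRHS]mulr1 ltr_pM2l// ltr_pdivrMr// mul1r ltr_nat.
- move=> x y xy Ex Ey; have [_ _ EPx] := EP (X x).
  have sE : E (X x) `<=` \big[setU/set0]_j E j.
    by move=> z Ez; rewrite (bigD1 (X x))//=; left.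
  by apply/esym/(EPx x) => // /sE.
Qed.

End Approximation.

(** * Coding orbits by cells *)

Section PartitionCoding.
Context (disp : measure_display) (T : measurableType disp) (R : realType).
Variables (mu : probability T R) (f : T -> T).
Hypothesis f_meas : measurable_fun setT f.
Hypothesis f_inv : invariant_measure mu f.

Lemma iter_measurable n : measurable_fun setT (iter n f).
Proof.
elim: n => [|n IHn]; first exact: measurable_id.
exact: (measurableT_comp f_meas IHn).
Qed.

Lemma iter_invariant n : invariant_measure mu (iter n f).
Proof.
elim: n => [//|n IHn] A mA.
have mfA : measurable (iter n f @^-1` A).
  by rewrite -[X in measurable X]setTI; exact: iter_measurable.
rewrite -(IHn A mA) -(f_inv mfA); congr (mu _).
by apply/seteqP; split => x /=; rewrite -iterS iterSr.
Qed.

Lemma partition_index m (A : 'I_m -> set T) : finite_partition A ->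
  exists2 alpha : T -> 'I_m, fibers_measurable alpha &
    forall n, join_entropy mu f A n = entropy mu (word f alpha n).
Proof.
move=> [mA tA cA].
have /choice[alpha alphaP] : forall x, exists i, A i x.
  by move=> x; have : setT x by []; rewrite -cA => -[i _ Aix]; exists i.
have AE i x : A i x <-> alpha x = i.
  split=> [Aix|<-//].
  by apply: (tA) => //; exists x; split.
have fiber i : alpha @^-1` [set i] = A i.
  by apply/seteqP; split => x /=; move/AE.
exists alpha => [i|n]; first by rewrite fiber.
rewrite /join_entropy /entropy /law; congr (- _); apply: eq_bigr => w _.
have -> // : join_atom f A w = word f alpha n @^-1` [set w].
apply/seteqP; split => x /=.
  by move=> xw; apply/ffunP => j; rewrite ffunE; apply/AE; exact: xw.
by move=> <- j _ /=; rewrite ffunE; exact/AE.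
Qed.

Section Block.
Variables (I : finType) (alpha : T -> I) (n : nat).
Hypothesis alpha_meas : fibers_measurable alpha.
Hypothesis n_gt0 : (0 < n)%N.
Variables (B : finType) (beta : T -> B) (E : set T).
Hypothesis beta_meas : fibers_measurable beta.
Hypothesis E_meas : measurable E.
Hypothesis beta_alpha : forall x y, beta x = beta y -> ~ E x -> ~ E y ->
  word f alpha n x = word f alpha n y.

Local Notation g := (iter n f).
Local Notation J := {ffun 'I_n -> I}.

Definition reach (b : B) : {set B} :=
  [set b' | `[< exists x, beta x = b /\ beta (g x) = b' >]]%SET.

(** A point of E is coded by its cell and its whole name; outside E the cell
   determines the name. *)
Definition coding (x : T) : B * option J :=
  (beta x, if `[< E x >] then Some (word f alpha n x) else None).

Lemma coding_fibers : fibers_measurable coding.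
Proof.
have mW := word_fibers f_meas (n := n) alpha_meas.
apply: pair_fibers => // -[j|].
  have := measurableI _ _ E_meas (mW j); congr measurable.
  apply/seteqP; split => x /=; first by move=> [Ex <-]; case: asboolP.
  by case: asboolP => // Ex [<-].
have := measurableC E_meas; congr measurable.
apply/seteqP; split => x /=; by case: asboolP.
Qed.

Lemma coding_decode : exists phi : B * option J -> J,
  forall x, phi (coding x) = word f alpha n x.
Proof.
have /choice[kappa kappaP] : forall b, exists j : J,
    forall x, beta x = b -> ~ E x -> word f alpha n x = j.
  move=> b; have [[x [xb Ex]]|none] := pselect (exists x, beta x = b /\ ~ E x).
    by exists (word f alpha n x) => y yb Ey; apply: beta_alpha => //; rewrite yb.
  exists (word f alpha n point) => x xb Ex.
  by case: none; exists x.
exists (fun z => odflt (kappa z.1) z.2) => x; rewrite /coding/=.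
by case: asboolP => //= Ex; rewrite -(kappaP (beta x) x).
Qed.

(** Position j of the name of length n N is position j mod n of the name of the
   point reached after j / n steps of g. *)
Lemma word_of_coding N : exists h : {ffun 'I_N -> B * option J} -> {ffun 'I_(n * N) -> I},
  word f alpha (n * N) = h \o word g coding N.
Proof.
have [phi phiP] := coding_decode.
have ltN (j : 'I_(n * N)) : (j %/ n < N)%N by rewrite ltn_divLR// [(N * n)%N]mulnC.
have ltn' (j : 'I_(n * N)) : (j %% n < n)%N by rewrite ltn_mod.
exists (fun w => [ffun j => phi (w (Ordinal (ltN j))) (Ordinal (ltn' j))]).
apply/funext => x; apply/ffunP => j; rewrite !ffunE/= ?ffunE phiP !ffunE/=.
rewrite -iterM -iterD; congr (alpha (iter _ f x)).
by rewrite addnC; exact: divn_eq.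
Qed.

(** The transition from a cell to the next one is coded by choosing uniformly
   among the cells that can be reached. *)
Lemma entropy_block (c : B -> R) N :
  (forall x, ln #|reach (beta x)|%:R <= c (beta x)) ->
  entropy mu (word f alpha (n * N.+1)) <= ln #|{: B * option J}|%:R +
    N%:R * (expect mu beta c + ln 2 + ln #|J|%:R * fine (mu E)).
Proof.
move=> reach_c; have mz := coding_fibers.
have [h ->] := word_of_coding N.+1.
have mg := iter_measurable n; have ig := iter_invariant n.
apply: (le_trans (entropy_comp mu h (word_fibers mg mz))).
pose w (o : option J) : R := if o is Some _ then (2 * #|J|%:R)^-1 else 2^-1.
pose Q (z z' : B * option J) : R :=
  (z'.1 \in reach z.1)%:R / #|reach z.1|%:R * w z'.2.
have J0 : 0 < #|J|%:R :> R.
  by rewrite ltr0n; apply/card_gt0P; exists (word f alpha n point).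
have w0 o : 0 < w o by case: o => [j|] /=; rewrite invr_gt0// mulr_gt0.
have w_le1 : \sum_o w o <= 1.
  rewrite (bigD1 None)//= (reindex_onto Some (odflt (word f alpha n point)))/=; last first.
    by case.
  rewrite (eq_bigl xpredT); last by move=> j /=; rewrite eqxx.
  rewrite sumr_const -[X in _ + X]mulr_natl invfM mulrCA divff ?gt_eqF// mulr1.
  lra.
have Q0 z z' : 0 <= Q z z'.
  by rewrite /Q mulr_ge0 ?divr_ge0// ltW.
have reach_card x : 0 < #|reach (beta x)|%:R :> R.
  rewrite ltr0n; apply/card_gt0P; exists (beta (g x)).
  by rewrite inE; apply/asboolP; exists x.
have Q1 z : \sum_z' Q z z' <= 1.
  rewrite -(pair_bigA _ (fun b o =>
    (b \in reach z.1)%:R / #|reach z.1|%:R * w o))/=.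
  under eq_bigr do rewrite -mulr_sumr.
  rewrite -mulr_suml -mulr_suml.
  have -> : \sum_b (b \in reach z.1)%:R = #|reach z.1|%:R :> R.
    rewrite -sum1_card natr_sum [RHS]big_mkcond/=.
    by apply: eq_bigr => b _; case: (b \in _).
  have [->|r0] := eqVneq #|reach z.1|%:R (0 : R); first by rewrite mul0r mul0r.
  by rewrite divff// mul1r.
have step x : (coding (g x)).1 \in reach (coding x).1.
  by rewrite inE; apply/asboolP; exists x.
have QE x : Q (coding x) (coding (g x)) =
    #|reach (beta x)|%:R^-1 * w (coding (g x)).2 by rewrite /Q step mul1r.
have Qpos x : 0 < Q (coding x) (coding (g x)).
  by rewrite QE mulr_gt0// invr_gt0.
apply: (le_trans (entropy_word mg ig N mz Q0 Q1 Qpos)).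
rewrite lerD2l ler_wpM2l//.
pose cost2 (z : B * option J) : R := ln 2 + ln #|J|%:R * (z.2 != None)%:R.
have mzg : fibers_measurable (fun x => (coding x, coding (g x))).
  by apply: pair_fibers => //; exact: (iter_fibers mg 1).
apply: (@le_trans _ _ (expect mu (fun x => (coding x, coding (g x)))
    (fun p => (c \o fst \o fst) p + (cost2 \o snd) p))).
  apply: expect_le => x; rewrite [X in - ln X]QE lnM ?posrE ?invr_gt0// opprD.
  rewrite lnV ?posrE// opprK lerD//.
  rewrite /cost2/=; case: asboolP => _ /=.
    by rewrite lnV ?posrE ?mulr_gt0// opprK lnM ?posrE// mulr1.
  by rewrite lnV ?posrE// opprK mulr0 addr0.
rewrite expectD -addrA lerD//.
  by rewrite -(expect_comp mu (fst \o fst) c mzg).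
rewrite -(expect_comp mu snd cost2 mzg).
rewrite -[X in expect mu X]/(coding \o iter 1 g).
rewrite /expect (law_iter mg ig 1 mz) -/(expect mu coding cost2).
rewrite expectD expect_cst// lerD2l expectZ ler_wpM2l ?ln_ge0 ?ler1n -?(ltr0n R)//.
rewrite expect_indicator//.
have -> // : coding @^-1` [set z | z.2 != None] = E.
apply/seteqP; split => x /=; first by case: asboolP.
by case: asboolP.
Qed.

End Block.
End PartitionCoding.

(** * Real-valued norms on complex vectors *)

Section ComplexNorms.
Variable R : realType.
Local Notation C := (cplx R).

(** The norms of C and C^n take their values in C; cabs and nrm are the same
   norms with values in R. *)
Definition cabs (c : C) : R := ComplexField.Normc.normc c.

Lemma normE (c : C) : `|c| = real_complex R (cabs c).
Proof. by []. Qed.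

Lemma cabs_ge0 c : 0 <= cabs c.
Proof. by case: c => a b; exact: sqrtr_ge0. Qed.

Lemma cabsM (a b : C) : cabs (a * b) = cabs a * cabs b.
Proof. exact: ComplexField.Normc.normcM. Qed.

Lemma cabsV (a : C) : cabs a^-1 = (cabs a)^-1.
Proof. exact: ComplexField.Normc.normcV. Qed.

Lemma cabs0 : cabs 0 = 0.
Proof. exact: ComplexField.Normc.normc0. Qed.

Lemma cabs1 : cabs 1 = 1.
Proof. exact: ComplexField.Normc.normc1. Qed.

Lemma cabs_eq0 c : (cabs c == 0) = (c == 0).
Proof.
by apply/eqP/eqP => [/ComplexField.Normc.eq0_normc//|->]; exact: cabs0.
Qed.

Lemma cabs_gt0 c : (0 < cabs c) = (c != 0).
Proof. by rewrite lt_neqAle cabs_ge0 andbT eq_sym cabs_eq0. Qed.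

Lemma cabsD (a b : C) : cabs (a + b) <= cabs a + cabs b.
Proof. exact: le_normcD. Qed.

Lemma cabsN (a : C) : cabs (- a) = cabs a.
Proof. exact: normcN. Qed.

Lemma cabsB (a b : C) : cabs (a - b) <= cabs a + cabs b.
Proof. by rewrite -(cabsN b); exact: cabsD. Qed.

Lemma cabsX (a : C) n : cabs (a ^+ n) = cabs a ^+ n.
Proof.
by elim: n => [|n IHn]; rewrite ?expr0 ?cabs1// !exprS cabsM IHn.
Qed.

Lemma cabs_sum (I : finType) (F : I -> C) :
  cabs (\sum_i F i) <= \sum_i cabs (F i).
Proof.
elim/big_ind2: _ => [|x a y b xa yb|//]; first by rewrite cabs0.
by rewrite (le_trans (cabsD _ _))// lerD.
Qed.

Lemma cabs_Re (c : C) : `|complex.Re c| <= cabs c.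
Proof.
case: c => a b /=; rewrite -sqrtr_sqr ler_sqrt ?addr_ge0 ?sqr_ge0//.
by rewrite lerDl sqr_ge0.
Qed.

Lemma cabs_Im (c : C) : `|complex.Im c| <= cabs c.
Proof.
case: c => a b /=; rewrite -sqrtr_sqr ler_sqrt ?addr_ge0 ?sqr_ge0//.
by rewrite lerDr sqr_ge0.
Qed.

Lemma cabs_le_ReIm (c : C) : cabs c <= `|complex.Re c| + `|complex.Im c|.
Proof.
case: c => a b /=; rewrite -[leRHS]ger0_norm ?addr_ge0//.
rewrite -[leRHS]sqrtr_sqr ler_sqrt ?sqr_ge0// sqrrD !real_normK ?num_real//.
by rewrite lerD2r lerDl mulrn_wge0// mulr_ge0.
Qed.

Lemma cabs_real (x : R) : cabs (real_complex R x) = `|x|.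
Proof. by rewrite /cabs /= expr0n addr0 sqrtr_sqr. Qed.

Lemma cplx_gt0 (e : C) : 0 < e -> exists2 r : R, 0 < r & e = real_complex R r.
Proof.
case: e => a b; rewrite ltcE/= => /andP[/eqP b0 a0].
by exists a => //; rewrite b0.
Qed.

Lemma row_subE n (z w : 'rV[C]_n) i :
  (z - w) ord0 i = z ord0 i - w ord0 i.
Proof. by rewrite !mxE. Qed.

Section Vectors.
Variable n : nat.
Implicit Types z w : 'rV[C]_n.

Definition nrm z : R := \big[Num.max/0]_i cabs (z ord0 i).

Lemma nrm_ge0 z : 0 <= nrm z.
Proof. exact: bigmax_ge_id. Qed.

Lemma nrm_ge z i : cabs (z ord0 i) <= nrm z.
Proof. exact: le_bigmax. Qed.

Lemma nrm_le z (b : R) :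
  0 <= b -> (forall i, cabs (z ord0 i) <= b) -> nrm z <= b.
Proof. by move=> b0 zb; apply/bigmax_leP; split. Qed.

Lemma nrm0 : nrm 0 = 0.
Proof.
apply/eqP; rewrite eq_le nrm_ge0 andbT nrm_le// => i.
by rewrite mxE cabs0.
Qed.

Lemma nrmD z w : nrm (z + w) <= nrm z + nrm w.
Proof.
apply: nrm_le => [|i]; first by rewrite addr_ge0 ?nrm_ge0.
by rewrite mxE (le_trans (cabsD _ _))// lerD ?nrm_ge.
Qed.

Lemma nrmN z : nrm (- z) = nrm z.
Proof. by apply: eq_bigr => i _; rewrite mxE cabsN. Qed.

Lemma nrmBC z w : nrm (z - w) = nrm (w - z).
Proof. by rewrite -nrmN opprB. Qed.

Lemma nrm_triangle z w : nrm z <= nrm w + nrm (z - w).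
Proof. by rewrite -[in leLHS](subrK w z) addrC nrmD. Qed.

Lemma nrm_eq0 z : (nrm z == 0) = (z == 0).
Proof.
apply/eqP/eqP => [z0|->]; last exact: nrm0.
apply/rowP => i; rewrite mxE; apply/eqP; rewrite -cabs_eq0 eq_le cabs_ge0.
by rewrite andbT -z0 nrm_ge.
Qed.

Lemma nrm_gt0 z : (0 < nrm z) = (z != 0).
Proof. by rewrite lt_neqAle nrm_ge0 andbT eq_sym nrm_eq0. Qed.

Lemma nrm_attained z : z != 0 -> exists i, nrm z = cabs (z ord0 i).
Proof.
move=> z0; case: (pickP (xpredT : pred 'I_n)) => [i0 _|n0]; last first.
  by move: z0; rewrite -nrm_eq0 /nrm big_pred0 ?eqxx.
rewrite /nrm; have [i _ ->] := @eq_bigmax _ _ _ 0 i0 xpredT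
  (fun i => cabs (z ord0 i)) isT (fun i _ => cabs_ge0 _).
by exists i.
Qed.

Lemma nrmZ (c : C) z : nrm (c *: z) = cabs c * nrm z.
Proof.
have [->|z0] := eqVneq z 0; first by rewrite scaler0 nrm0 mulr0.
apply/le_anti/andP; split.
  apply: nrm_le => [|i]; first by rewrite mulr_ge0 ?cabs_ge0 ?nrm_ge0.
  by rewrite mxE cabsM ler_wpM2l ?cabs_ge0 ?nrm_ge.
have [i ->] := nrm_attained z0.
by apply: le_trans (nrm_ge _ i); rewrite mxE cabsM.
Qed.

Lemma mx_norm_nrm z : `|z| = real_complex R (nrm z).
Proof.
apply/le_anti/andP; split.
  have [->|z0] := eqVneq z 0; first by rewrite normr0 nrm0.
  have : `|z| != 0 by rewrite normr_eq0.
  case/mx_norm_neq0 => -[i j] zE.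
  rewrite [leLHS]zE (ord1 i) normE lecR.
  exact: nrm_ge.
have [->|z0] := eqVneq z 0; first by rewrite normr0 nrm0.
have [i ->] := nrm_attained z0; rewrite -normE -[leRHS]/(mx_norm z) mx_normE.
rewrite -[leLHS]nngE num_le.
exact: (le_bigmax _ (fun ij => `|z ij.1 ij.2|%:nng) (ord0, i)).
Qed.

End Vectors.
End ComplexNorms.

(** * Second order expansions on balls *)

Section SecondOrder.
Variables (R : realType) (m : nat).
Local Notation C := (cplx R).

(** First order expansions with quadratic remainder, where a single constant works
   for all points of a ball.  Polynomials have them, and the property passes to
   compositions, hence to iterates. *)
Definition scalar_uniform_taylor (phi : 'rV[C]_m -> C) : Prop :=
  forall rho : R, exists2 K : R, 0 <= K & forall z, nrm z <= rho ->
    cabs (phi z) <= K /\ exists2 a : 'cV[C]_m,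
      forall j, cabs (a j ord0) <= K &
      forall w, nrm w <= rho -> cabs (phi w - phi z) <= K * nrm (w - z) /\
        cabs (phi w - phi z - ((w - z) *m a) ord0 ord0) <= K * nrm (w - z) ^+ 2.

Definition uniform_taylor (G : 'rV[C]_m -> 'rV[C]_m) : Prop :=
  forall rho : R, exists2 K : R, 0 <= K & forall z, nrm z <= rho ->
    nrm (G z) <= K /\ exists2 M : 'M[C]_m,
      forall v : 'rV[C]_m, nrm (v *m M) <= K * nrm v &
      forall w, nrm w <= rho -> nrm (G w - G z) <= K * nrm (w - z) /\
        nrm (G w - G z - (w - z) *m M) <= K * nrm (w - z) ^+ 2.

Lemma scalar_uniform_taylor_cst c : scalar_uniform_taylor (fun=> c).
Proof.
move=> rho; exists (cabs c); first exact: cabs_ge0.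
move=> z _; split=> //; exists 0; first by move=> j; rewrite mxE cabs0 cabs_ge0.
move=> w _; rewrite subrr mulmx0 mxE subr0 cabs0.
by split; rewrite mulr_ge0 ?exprn_ge0 ?nrm_ge0 ?cabs_ge0.
Qed.

Lemma scalar_uniform_taylor_coord i : scalar_uniform_taylor (fun z => z ord0 i).
Proof.
move=> rho; exists (`|rho| + 1); first by rewrite addr_ge0.
have K0 : 0 <= `|rho| + 1 by rewrite addr_ge0.
have K1 : 1 <= `|rho| + 1 by rewrite lerDr.
move=> z z_rho; split.
  rewrite (le_trans (nrm_ge _ _))// (le_trans z_rho)// (le_trans (ler_norm _))//.
  by rewrite lerDl.
exists (delta_mx i ord0).
  by move=> j; rewrite mxE; case: (_ && _); rewrite ?cabs1 ?cabs0.
move=> w _; split.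
  apply: (@le_trans _ _ (nrm (w - z))); last by rewrite ler_peMl ?nrm_ge0.
  by apply: le_trans (nrm_ge _ i); rewrite !mxE.
rewrite -colE !mxE subrr cabs0.
by rewrite mulr_ge0 ?exprn_ge0 ?nrm_ge0.
Qed.

Lemma scalar_uniform_taylorD phi psi :
  scalar_uniform_taylor phi -> scalar_uniform_taylor psi -> scalar_uniform_taylor (fun z => phi z + psi z).
Proof.
move=> phi2 psi2 rho; have [K K0 KP] := phi2 rho; have [L L0 LP] := psi2 rho.
exists (K + L); first by rewrite addr_ge0.
move=> z zr; have [bK [a aK aP]] := KP z zr; have [bL [b bL' bP]] := LP z zr.
split; first by rewrite (le_trans (cabsD _ _))// lerD.
exists (a + b).
  by move=> j; rewrite mxE (le_trans (cabsD _ _))// lerD.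
move=> w wr; have [a1 a2] := aP w wr; have [b1 b2] := bP w wr.
rewrite mulmxDr mxE !mulrDl; split.
  rewrite opprD addrACA (le_trans (cabsD _ _))// lerD//.
have -> : phi w + psi w - (phi z + psi z) -
    (((w - z) *m a) ord0 ord0 + ((w - z) *m b) ord0 ord0) =
  (phi w - phi z - ((w - z) *m a) ord0 ord0) +
  (psi w - psi z - ((w - z) *m b) ord0 ord0) by ring.
by rewrite (le_trans (cabsD _ _))// lerD.
Qed.

Lemma scalar_uniform_taylorM phi psi :
  scalar_uniform_taylor phi -> scalar_uniform_taylor psi -> scalar_uniform_taylor (fun z => phi z * psi z).
Proof.
move=> phi2 psi2 rho; have [K K0 KP] := phi2 rho; have [L L0 LP] := psi2 rho.
have KL0 : 0 <= K * L by rewrite mulr_ge0.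
exists (3 * (K * L)); first by rewrite mulr_ge0.
move=> z zr; have [bK [a aK aP]] := KP z zr; have [bL [b bL' bP]] := LP z zr.
have le_prod (x y : C) (s t : R) :
    cabs x <= s -> cabs y <= t -> cabs (x * y) <= s * t.
  by move=> xs yt; rewrite cabsM ler_pM ?cabs_ge0.
split; first by rewrite (le_trans (le_prod _ _ _ _ bK bL))//; lra.
exists (psi z *: a + phi z *: b).
  move=> j; rewrite !mxE (le_trans (cabsD _ _))//.
  have := le_prod _ _ _ _ bL (aK j); have := le_prod _ _ _ _ bK (bL' j); lra.
move=> w wr; have [a1 a2] := aP w wr; have [b1 b2] := bP w wr.
have [bK' _] := KP w wr.
set h := nrm (w - z) in a1 a2 b1 b2 *; have h0 : 0 <= h by exact: nrm_ge0.
have KLh : 0 <= K * L * h by rewrite mulr_ge0.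
have KLhh : 0 <= K * L * h ^+ 2 by rewrite mulr_ge0 ?exprn_ge0.
split.
  have -> : phi w * psi w - phi z * psi z =
    phi w * (psi w - psi z) + (phi w - phi z) * psi z by ring.
  rewrite (le_trans (cabsD _ _))//.
  have := le_prod _ _ _ _ bK' b1; have := le_prod _ _ _ _ a1 bL.
  rewrite (_ : K * h * L = K * L * h); last by ring.
  rewrite (_ : K * (L * h) = K * L * h); last by ring.
  lra.
have linE : ((w - z) *m (psi z *: a + phi z *: b)) ord0 ord0 =
    psi z * ((w - z) *m a) ord0 ord0 + phi z * ((w - z) *m b) ord0 ord0.
  by rewrite mulmxDr -!scalemxAr mxE; congr (_ + _); rewrite mxE.
rewrite linE.
have -> : phi w * psi w - phi z * psi z -
    (psi z * ((w - z) *m a) ord0 ord0 + phi z * ((w - z) *m b) ord0 ord0) =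
  phi z * (psi w - psi z - ((w - z) *m b) ord0 ord0) +
  (phi w - phi z - ((w - z) *m a) ord0 ord0) * psi z +
  (phi w - phi z) * (psi w - psi z) by ring.
rewrite (le_trans (cabsD _ _))//.
have le3 := le_prod _ _ _ _ a1 b1.
have le1 := le_prod _ _ _ _ bK b2; have le2 := le_prod _ _ _ _ a2 bL.
have := cabsD (phi z * (psi w - psi z - ((w - z) *m b) ord0 ord0))
  ((phi w - phi z - ((w - z) *m a) ord0 ord0) * psi z).
rewrite (_ : K * (L * h ^+ 2) = K * L * h ^+ 2) in le1; last by ring.
rewrite (_ : K * h ^+ 2 * L = K * L * h ^+ 2) in le2; last by ring.
rewrite (_ : K * h * (L * h) = K * L * h ^+ 2) in le3; last by ring.
lra.
Qed.

Lemma scalar_uniform_taylor_meval (p : mpoly.mpoly m C) :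
  scalar_uniform_taylor (fun z => mpoly.meval (z ord0) p).
Proof.
rewrite (_ : (fun z : 'rV_m => _) = fun z : 'rV[C]_m =>
  \sum_(u <- mpoly.msupp p) mpoly.mcoeff u p *
     \prod_i z ord0 i ^+ mpoly.fun_of_multinom u i); last first.
  by apply/funext => z; rewrite mpoly.mevalE.
elim: (mpoly.msupp p) => [|u s IHs].
  under eq_fun do rewrite big_nil; exact: scalar_uniform_taylor_cst.
under eq_fun do rewrite big_cons; apply: scalar_uniform_taylorD => //.
apply: scalar_uniform_taylorM; first exact: scalar_uniform_taylor_cst.
elim: (index_enum _) => [|i t IHt].
  under eq_fun do rewrite big_nil; exact: scalar_uniform_taylor_cst.
under eq_fun do rewrite big_cons; apply: scalar_uniform_taylorM => //.
elim: (mpoly.fun_of_multinom u i) => [|e IHe].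
  under eq_fun do rewrite expr0; exact: scalar_uniform_taylor_cst.
by under eq_fun do rewrite exprS; apply: scalar_uniform_taylorM => //; exact: scalar_uniform_taylor_coord.
Qed.

Lemma uniform_taylor_components (G : 'rV[C]_m -> 'rV[C]_m) :
  (forall i, scalar_uniform_taylor (fun z => G z ord0 i)) -> uniform_taylor G.
Proof.
move=> G2 rho.
have /choice[K KP] : forall i, exists K : R, 0 <= K /\
    forall z, nrm z <= rho ->
    cabs (G z ord0 i) <= K /\ exists2 a : 'cV[C]_m,
      forall j, cabs (a j ord0) <= K &
      forall w, nrm w <= rho -> cabs (G w ord0 i - G z ord0 i) <= K * nrm (w - z) /\
        cabs (G w ord0 i - G z ord0 i - ((w - z) *m a) ord0 ord0) <=
          K * nrm (w - z) ^+ 2.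
  by move=> i; have [K ? ?] := G2 i rho; exists K.
pose L := \sum_i m.+1%:R * K i.
have K0 i : 0 <= K i by have [] := KP i.
have mKL i : m.+1%:R * K i <= L.
  by rewrite /L (bigD1 i)//= lerDl sumr_ge0// => j _; rewrite mulr_ge0.
have KL i : K i <= L.
  by rewrite (le_trans _ (mKL i))// ler_peMl// ler1n.
have L0 : 0 <= L by rewrite sumr_ge0// => i _; rewrite mulr_ge0.
exists L => // z zr; split.
  by apply: nrm_le => // i; have [_ /(_ z zr)[le _]] := KP i; exact: le_trans (KL i).
have /choice[a aP] : forall i, exists a : 'cV[C]_m,
    (forall j, cabs (a j ord0) <= K i) /\
    forall w, nrm w <= rho -> cabs (G w ord0 i - G z ord0 i) <= K i * nrm (w - z) /\
        cabs (G w ord0 i - G z ord0 i - ((w - z) *m a) ord0 ord0) <=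
          K i * nrm (w - z) ^+ 2.
  by move=> i; have [_ /(_ z zr)[_ [a ? ?]]] := KP i; exists a.
pose M := \matrix_(j, i) a i j ord0.
have vM (v : 'rV[C]_m) i : (v *m M) ord0 i = (v *m a i) ord0 ord0.
  by rewrite !mxE; apply: eq_bigr => j _; rewrite !mxE.
exists M.
  move=> v; apply: nrm_le => [|i]; first by rewrite mulr_ge0 ?nrm_ge0.
  apply: (@le_trans _ _ (m.+1%:R * K i * nrm v)); last first.
    by rewrite ler_wpM2r ?nrm_ge0.
  rewrite vM mxE (le_trans (cabs_sum _))//.
  apply: (@le_trans _ _ (\sum_(j < m) K i * nrm v)).
    apply: ler_sum => j _; rewrite cabsM mulrC ler_pM ?cabs_ge0 ?nrm_ge//.
    by have [] := aP i.
  rewrite sumr_const card_ord -[leLHS]mulr_natl -mulrA.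
  by rewrite ler_wpM2r ?mulr_ge0 ?nrm_ge0// ler_nat.
move=> w wr; split; apply: nrm_le => [|i].
- by rewrite mulr_ge0 ?nrm_ge0.
- rewrite !mxE; have [_ /(_ w wr)[le _]] := aP i; apply: (le_trans le).
  by rewrite ler_wpM2r ?nrm_ge0.
- by rewrite mulr_ge0 ?exprn_ge0 ?nrm_ge0.
- rewrite 2!row_subE vM.
  have [_ /(_ w wr)[_ le]] := aP i; apply: (le_trans le).
  by rewrite ler_wpM2r ?exprn_ge0 ?nrm_ge0.
Qed.

Lemma uniform_taylor_id : uniform_taylor id.
Proof.
apply: uniform_taylor_components => i; exact: scalar_uniform_taylor_coord.
Qed.

(** The linear part is the product of the linear parts.  The bound on these is
   part of the definition because the remainder of F is transported by that of
   G. *)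
Lemma uniform_taylor_comp (F G : 'rV[C]_m -> 'rV[C]_m) : uniform_taylor F -> uniform_taylor G -> uniform_taylor (G \o F).
Proof.
move=> F2 G2 rho; have [K K0 KP] := F2 rho; have [L L0 LP] := G2 K.
have LK0 : 0 <= L * K by rewrite mulr_ge0.
have LKK0 : 0 <= L * K ^+ 2 by rewrite mulr_ge0 ?exprn_ge0.
exists (L + L * K + L * K ^+ 2); first by rewrite !addr_ge0.
move=> z zr; have [FzK [M MK MP]] := KP z zr.
have [GzL [N NL NP]] := LP _ FzK.
split; first by rewrite /= (le_trans GzL)//; lra.
exists (M *m N).
  move=> v; rewrite mulmxA (le_trans (NL _))//.
  rewrite (le_trans (ler_wpM2l L0 (MK v)))// mulrA ler_wpM2r ?nrm_ge0//; lra.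
move=> w wr; have [FwK _] := KP w wr; have [le1 le2] := MP w wr.
have [le3 le4] := NP _ FwK.
set h := nrm (w - z) in le1 le2 *; have h0 : 0 <= h by exact: nrm_ge0.
have hh0 : 0 <= h ^+ 2 by rewrite exprn_ge0.
split.
  rewrite /= (le_trans le3)// (le_trans (ler_wpM2l L0 le1))// mulrA.
  by rewrite ler_wpM2r//; lra.
have -> : (G \o F) w - (G \o F) z - (w - z) *m (M *m N) =
  (G (F w) - G (F z) - (F w - F z) *m N) + (F w - F z - (w - z) *m M) *m N.
  by rewrite [(_ - _ *m M) *m N]mulmxBl mulmxA addrA subrK.
rewrite (le_trans (nrmD _ _))//.
apply: (@le_trans _ _ (L * (K * h) ^+ 2 + L * (K * h ^+ 2))).
  rewrite lerD//.
    rewrite (le_trans le4)// ler_wpM2l// ler_pXn2r// ?nnegrE ?nrm_ge0//.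
    by rewrite mulr_ge0.
  by rewrite (le_trans (NL _))// ler_wpM2l.
rewrite (_ : _ + _ = (L * K + L * K ^+ 2) * h ^+ 2); last by ring.
by rewrite ler_wpM2r//; lra.
Qed.

Lemma uniform_taylor_iter (F : 'rV[C]_m -> 'rV[C]_m) n : uniform_taylor F -> uniform_taylor (iter n F).
Proof.
move=> F2; elim: n => [|n IHn]; first exact: uniform_taylor_id.
exact: (uniform_taylor_comp IHn F2).
Qed.

Lemma nbhs_nrmP (z : 'rV[C]_m) (P : set 'rV[C]_m) :
  nbhs z P <-> exists2 r : R, 0 < r & forall w, nrm (w - z) < r -> P w.
Proof.
split=> [/nbhs_normP[/= _ /cplx_gt0[r r0 ->] rP]|[r r0 rP]].
  by exists r => // w wz; apply: rP; rewrite /= mx_norm_nrm nrmBC ltcR.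
apply/(nbhs_normP z P); exists (real_complex R r); first by rewrite /= ltcR.
by move=> w /=; rewrite mx_norm_nrm nrmBC ltcR; exact: rP.
Qed.

Lemma lipschitz_at_continuous (G : 'rV[C]_m -> 'rV[C]_m) (z : 'rV[C]_m) (K : R) :
  (forall w, nrm (w - z) <= 1 -> nrm (G w - G z) <= K * nrm (w - z)) ->
  {for z, continuous G}.
Proof.
move=> GK; apply/(@cvgrPdist_lt _ _ _ (nbhs z)) => _ /cplx_gt0[e e0 ->]; apply/nbhs_nrmP.
have K1 : 0 < `|K| + 1 by rewrite ltr_wpDl.
exists (Num.min 1 (e / (`|K| + 1))); first by rewrite lt_min ltr01 divr_gt0.
move=> w; rewrite lt_min => /andP[/ltW/GK w1 we].
rewrite mx_norm_nrm nrmBC ltcR (le_lt_trans w1)//.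
rewrite ltr_pdivlMr// mulrC in we; apply: le_lt_trans we.
by rewrite ler_wpM2r ?nrm_ge0// (le_trans (ler_norm _))// lerDl.
Qed.

Lemma diff_second_order (G : 'rV[C]_m -> 'rV[C]_m) (z : 'rV[C]_m) (M : 'M[C]_m)
    (K : R) : 0 <= K ->
  (forall v : 'rV[C]_m, nrm (v *m M) <= K * nrm v) ->
  (forall w, nrm (w - z) <= 1 ->
     nrm (G w - G z - (w - z) *m M) <= K * nrm (w - z) ^+ 2) ->
  differentiable G z /\ forall v, 'd G z v = v *m M.
Proof.
move=> K0 MK GM; have MC : continuous (mulmxr M : 'rV[C]_m -> 'rV[C]_m).
  move=> v; apply: (@lipschitz_at_continuous _ _ K) => w _.
  by rewrite /= -mulmxBl MK.
have near_le (eps : C) : 0 < eps -> \forall w \near (0 : 'rV[C]_m),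
    `|G (w + z) - (G z + w *m M)| <= eps * `|w|.
  move=> /cplx_gt0[e e0 ->]; apply/nbhs_nrmP.
  have K1 : 0 < K + 1 by rewrite ltr_wpDl.
  exists (Num.min 1 (e / (K + 1))); first by rewrite lt_min ltr01 divr_gt0.
  move=> w; rewrite subr0 lt_min => /andP[w1 we].
  rewrite ltr_pdivlMr// in we.
  rewrite !mx_norm_nrm -rmorphM/= lecR opprD addrA.
  have := GM (w + z); rewrite addrK => /(_ (ltW w1)) le1.
  rewrite (le_trans le1)// expr2 mulrA ler_wpM2r ?nrm_ge0// mulrC.
  by rewrite (le_trans _ (ltW we))// ler_wpM2l ?nrm_ge0// lerDl.
have dE : 'd G z = mulmxr M :> ('rV[C]_m -> 'rV[C]_m).
  by apply: diff_unique MC _; apply/eqaddoP => eps eps0; exact: near_le.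
split; last by move=> v; rewrite dE.
apply/diff_locallyP; rewrite dE; split => //.
by apply/eqaddoP => eps eps0; exact: near_le.
Qed.

(** The matrix of the expansion at z is that of the differential, because a linear
   part with quadratic remainder is unique. *)
Lemma uniform_taylor_expansion (G : 'rV[C]_m -> 'rV[C]_m) (rho : R) : uniform_taylor G ->
  exists2 K : R, 0 < K & forall z w, nrm z <= rho -> nrm w <= rho ->
    [/\ nrm (G z) <= K, nrm (G w - G z) <= K * nrm (w - z) &
        nrm (G w - G z - 'd G z (w - z)) <= K * nrm (w - z) ^+ 2].
Proof.
move=> /(_ (rho + 1))[K K0 KP]; exists (K + 1); first by rewrite ltr_wpDl.
move=> z w zr wr; have zr1 : nrm z <= rho + 1 by rewrite (le_trans zr)// lerDl.
have wr1 : nrm w <= rho + 1 by rewrite (le_trans wr)// lerDl.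
have [GzK [M MK MP]] := KP z zr1.
have [|_ dE] := @diff_second_order G z M K K0 MK.
  move=> u uz; have [|_ //] := MP u.
  by rewrite (le_trans (nrm_triangle u z))// lerD.
have K1 : K <= K + 1 by rewrite lerDl.
have [le1 le2] := MP w wr1; split; first exact: le_trans K1.
- by rewrite (le_trans le1)// ler_wpM2r ?nrm_ge0.
- by rewrite dE (le_trans le2)// ler_wpM2r// exprn_ge0// nrm_ge0.
Qed.

(** If G is homogeneous of degree D, then its differential is homogeneous of
   degree D - 1. *)
Lemma diff_homogeneous (G : 'rV[C]_m -> 'rV[C]_m) (a b : C) (z v : 'rV[C]_m) :
  uniform_taylor G -> a != 0 -> (forall u : 'rV[C]_m, G (a *: u) = b *: G u) ->
  'd G (a *: z) v = (b / a) *: 'd G z v.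
Proof.
move=> G2 a0 Gab.
have a0' : 0 < cabs a by rewrite cabs_gt0.
have ai0 : 0 <= (cabs a)^-1 by rewrite invr_ge0 ltW.
have [K K0 /(_ z)[|_ [M MK MP]]] := G2 (nrm z + 1 + (cabs a)^-1).
  by rewrite -addrA lerDl addr_ge0.
have dz : 'd G z v = v *m M.
  have [|_ ->//] := @diff_second_order G z M K K0 MK.
  move=> w wz; have [|_ //] := MP w.
  by rewrite (le_trans (nrm_triangle w z))// -addrA lerD2l (le_trans wz)// lerDl.
pose L := cabs (b / a) * K + cabs b * K * (cabs a)^-1 ^+ 2.
have L0 : 0 <= L by rewrite addr_ge0 ?mulr_ge0 ?cabs_ge0 ?exprn_ge0.
(* Both differentials are compared with multiples of the same matrix M, and a
   remainder at z, rescaled by a, is a remainder at a *: z. *)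
apply: (@etrans _ _ ((b / a) *: (v *m M))); last first.
  exact: (congr1 (fun h : 'rV[C]_m => (b / a) *: h) (esym dz)).
rewrite scalemxAr.
have [|w waz|_ dE] := @diff_second_order G (a *: z) ((b / a) *: M) L L0; last first.
- exact: dE.
- pose u := a^-1 *: w; have wE : w = a *: u by rewrite /u scalerA divff// scale1r.
  have uz : nrm (u - z) = (cabs a)^-1 * nrm (w - a *: z).
    by rewrite wE -scalerBr nrmZ mulrA mulVf ?mul1r// gt_eqF.
  have [|_ le1] := MP u.
    rewrite (le_trans (nrm_triangle u z))// -addrA lerD2l uz.
    by rewrite (@le_trans _ _ (cabs a)^-1) ?lerDr// ler_piMr.
  rewrite [X in nrm X](_ : _ = b *: (G u - G z - (u - z) *m M)); last first.
    rewrite wE !Gab -!scalerBr -scalemxAr -scalemxAl scalerA divfK//.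
    by rewrite -scalerBr.
  rewrite nrmZ (le_trans (ler_wpM2l (cabs_ge0 b) le1))// uz exprMn [leLHS]mulrA [leLHS]mulrA.
  rewrite ler_wpM2r ?exprn_ge0 ?nrm_ge0//.
  by rewrite /L lerDr mulr_ge0 ?cabs_ge0.
- move=> h; rewrite -scalemxAr nrmZ /L mulrDl.
  rewrite (@le_trans _ _ (cabs (b / a) * K * nrm h))//.
    by rewrite -mulrA ler_wpM2l ?cabs_ge0.
  by rewrite lerDl !mulr_ge0 ?cabs_ge0 ?exprn_ge0 ?nrm_ge0.
Qed.

End SecondOrder.

(** * The homogeneous lift *)

Section EndoLift.
Variables (R : realType) (k d : nat) (f : endo (cplx R) k d).
Local Notation C := (cplx R).
Local Notation F := (endo_lift f).

Lemma endo_lift_uniform_taylor : uniform_taylor F.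
Proof.
apply: uniform_taylor_components => i.
rewrite (_ : (fun z => _) = fun z : 'rV[C]_k.+1 =>
  mpoly.meval (z ord0) (endo_coord f i)); first exact: scalar_uniform_taylor_meval.
by apply/funext => z; rewrite mxE.
Qed.

Lemma endo_lift_homogeneous (a : C) (z : 'rV[C]_k.+1) :
  F (a *: z) = a ^+ d *: F z.
Proof.
apply/rowP => i; rewrite !mxE !mpoly.mevalE mulr_sumr.
apply: eq_bigr => u _; have [ud|ud] := eqVneq (mpoly.mdeg u) d; last first.
  by rewrite (mpoly.dhomog_nemf_coeff (endo_coord_homog f i) ud) !mul0r mulr0.
rewrite mulrCA; congr (_ * _); rewrite -ud.
rewrite mpoly.mdegE -prodrXr -big_split/=; apply: eq_bigr => j _.
by rewrite mxE exprMn.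
Qed.

Lemma iter_lift_homogeneous n (a : C) (z : 'rV[C]_k.+1) :
  iter n F (a *: z) = a ^+ (d ^ n) *: iter n F z.
Proof.
elim: n => [|n IHn]; first by rewrite /= expr1.
by rewrite !iterS IHn endo_lift_homogeneous -exprM expnSr.
Qed.

Lemma iter_lift_neq0 n (z : 'rV[C]_k.+1) : z != 0 -> iter n F z != 0.
Proof. by move=> z0; elim: n => [//|n IHn]; exact: endo_lift_neq0. Qed.

(** The lift does not vanish on the unit sphere, which is compact; homogeneity
   gives the other vectors.  The sphere is parametrized by the real and imaginary
   parts of the coordinates. *)
Lemma endo_lift_lower_bound :
  exists2 c : R, 0 < c & forall z : 'rV[C]_k.+1, c * nrm z ^+ d <= nrm (F z).
Proof.
pose toC (v : 'rV[R]_(k.+1 + k.+1)) : 'rV[C]_k.+1 :=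
  \row_i (Complex (v ord0 (lshift k.+1 i)) (v ord0 (rshift k.+1 i)) : C).
have toCB v w : toC v - toC w = toC (v - w).
  by apply/rowP => i; rewrite !mxE.
have entry_le (v : 'rV[R]_(k.+1 + k.+1)) j : `|v ord0 j| <= `|v|.
  rewrite [leRHS]mx_normrE.
  exact: (le_bigmax _ (fun ij => `|v ij.1 ij.2|) (ord0, j)).
have toC_le v : nrm (toC v) <= 2 * `|v|.
  apply: nrm_le => [|i]; first by rewrite mulr_ge0.
  rewrite mxE (le_trans (cabs_le_ReIm _))//= mulrDl mul1r.
  by rewrite lerD.
have toC_ge v : `|v| <= nrm (toC v).
  rewrite [leLHS]mx_normrE; apply/bigmax_leP; split; first exact: nrm_ge0.
  move=> -[i j] _ /=; have -> : i = ord0 by rewrite (ord1 i).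
  case: (split_ordP j) => l ->.
    by apply: le_trans (nrm_ge _ l); have := cabs_Re (toC v ord0 l); rewrite mxE.
  by apply: le_trans (nrm_ge _ l); have := cabs_Im (toC v ord0 l); rewrite mxE.
have toC_onto z : exists v, toC v = z.
  exists (row_mx (\row_i complex.Re (z ord0 i)) (\row_i complex.Im (z ord0 i))).
  apply/rowP => i; rewrite !mxE.
  case: splitP => [j /= /val_inj <-|j /= ij]; last first.
    by have := ltn_ord i; rewrite ij ltnNge leq_addr.
  case: splitP => [j' /= ij|j' /= /eqP]; last first.
    rewrite eqn_add2l => /eqP/val_inj <-; rewrite !mxE.
    by case: (z ord0 i).
  by have := ltn_ord j'; rewrite -ij ltnNge leq_addr.
have lip_cont (h : 'rV[R]_(k.+1 + k.+1) -> R) : (forall v, exists K : R,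
    forall w, `|v - w| <= 1 -> `|h v - h w| <= K * `|v - w|) -> continuous h.
  move=> hK v; have [K KP] := hK v.
  apply/(@cvgrPdist_lt _ _ _ (nbhs v)) => e e0.
  have K1 : 0 < `|K| + 1 by rewrite ltr_wpDl.
  apply/(nbhs_normP v).
  exists (Num.min 1 (e / (`|K| + 1))); first by rewrite /= lt_min ltr01 divr_gt0.
  move=> w /=; rewrite lt_min => /andP[/ltW/KP w1 we].
  rewrite (le_lt_trans w1)//.
  rewrite ltr_pdivlMr// mulrC in we; apply: le_lt_trans we.
  by rewrite ler_wpM2r// (le_trans (ler_norm _))// lerDl.
have nrm_dist (x y : 'rV[C]_k.+1) : `|nrm x - nrm y| <= nrm (x - y).
  have := nrm_triangle x y; have := nrm_triangle y x; rewrite (nrmBC y x).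
  by rewrite ler_norml; lra.
have cont1 : continuous (fun v => nrm (toC v)).
  apply: lip_cont => v; exists 2 => w _ /=.
  by rewrite (le_trans (nrm_dist _ _))// toCB.
have cont2 : continuous (fun v => nrm (F (toC v))).
  apply: lip_cont => v.
  have [K K0 KP] := uniform_taylor_expansion (nrm (toC v) + 2) endo_lift_uniform_taylor.
  exists (K * 2) => w vw /=; rewrite (le_trans (nrm_dist _ _))//.
  have wr : nrm (toC w) <= nrm (toC v) + 2.
    rewrite (le_trans (nrm_triangle _ (toC v)))// lerD2l nrmBC toCB.
    by rewrite (le_trans (toC_le _))// -[leRHS]mulr1 ler_pM2l.
  have [|_ le1 _] := KP (toC w) (toC v) wr; first by rewrite lerDl.
  by rewrite (le_trans le1)// -mulrA ler_pM2l// toCB.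
pose S := [set v | nrm (toC v) = 1].
have S0 : S !=set0.
  have [v vE] := toC_onto (const_mx 1); exists v; rewrite /S/= vE.
  apply/le_anti/andP; split.
    by apply: nrm_le => // i; rewrite mxE cabs1.
  by apply: le_trans (nrm_ge _ ord0); rewrite mxE cabs1.
have Scompact : compact S.
  apply: bounded_closed_compact.
    exists 1; split => // x x1 v /= Sv; rewrite (le_trans (toC_ge v))//.
    by rewrite Sv ltW.
  have -> : S = (fun v => nrm (toC v)) @^-1` [set 1] by [].
  by apply: closed_comp => [v _|]; [exact: cont1|exact: closed_eq].
have [v Sv vmin] := compact_EVT_min S0 Scompact (continuous_subspaceT cont2).
rewrite inE /S/= in Sv.
have v0 : toC v != 0 by rewrite -nrm_gt0 Sv.
exists (nrm (F (toC v))); first by rewrite nrm_gt0 endo_lift_neq0.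
move=> z; have [a [u [-> u1]]] : exists a u, z = a *: u /\ nrm u = 1.
  have [->|z0] := eqVneq z 0; first by exists 0, (toC v); rewrite scale0r.
  have nz0 : 0 < nrm z by rewrite nrm_gt0.
  pose a : C := real_complex R (nrm z).
  have aE : cabs a = nrm z by rewrite cabs_real ger0_norm ?nrm_ge0.
  have a0 : a != 0 by rewrite -cabs_gt0 aE.
  exists a, (a^-1 *: z); rewrite scalerA divff// scale1r nrmZ cabsV aE.
  by rewrite mulVf// gt_eqF.
rewrite endo_lift_homogeneous !nrmZ u1 mulr1 cabsX mulrC.
rewrite ler_wpM2l ?exprn_ge0 ?cabs_ge0//.
have [w wE] := toC_onto u; rewrite -wE.
by apply: vmin; rewrite inE /S/= wE.
Qed.

Lemma iter_lift_lower_bound n :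
  exists2 c : R, 0 < c &
    forall z : 'rV[C]_k.+1, nrm z = 1 -> c <= nrm (iter n F z).
Proof.
have [c c0 cP] := endo_lift_lower_bound.
elim: n => [|n [e e0 eP]]; first by exists 1 => // z ->.
exists (c * e ^+ d); first by rewrite mulr_gt0// exprn_gt0.
move=> z /eP ez; rewrite iterS (le_trans _ (cP _))// ler_pM2l//.
by rewrite lerXn2r// ?nnegrE ?nrm_ge0// ltW.
Qed.

End EndoLift.

(** * The topology of projective space *)

Section ProjectiveTopology.
Local Open Scope quotient_scope.
Variables (R : realType) (k : nat).
Local Notation C := (cplx R).
Local Notation CPk := (CP R k).

Lemma mk_nzvec_val (z : nzvec R k) (z0 : nzval z != 0) : mk_nzvec z0 = z.
Proof.
rewrite /mk_nzvec; case: z z0 => z zP z0; congr (exist _ _ _).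
exact: bool_irrelevance.
Qed.

Lemma proj_class_hcoord (x : CPk) : proj_class (mk_nzvec (hcoord_neq0 x)) = x.
Proof. by rewrite mk_nzvec_val; exact: reprK. Qed.

Lemma proj_classP (z w : nzvec R k) :
  proj_class z = proj_class w <-> exists2 c : C, c != 0 & nzval w = c *: nzval z.
Proof.
split=> [/eqmodP/asboolP//|zw].
by apply/eqmodP/asboolP.
Qed.

Lemma hcoord_proj_class (z : 'rV[C]_k.+1) (z0 : z != 0) :
  exists2 c : C, c != 0 & hcoord (proj_class (mk_nzvec z0)) = c *: z.
Proof.
have /esym/proj_classP[c c0 cE] := proj_class_hcoord (proj_class (mk_nzvec z0)).
by exists c.
Qed.

Lemma hcoord_iter d (f : endo C k d) n (x : CPk) :
  exists2 c : C, c != 0 &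
    hcoord (iter n (endo_map f) x) = c *: iter n (endo_lift f) (hcoord x).
Proof.
elim: n => [|n [c c0 IHn]]; first by exists 1; rewrite ?oner_neq0 ?scale1r.
have [b b0 bE] := hcoord_proj_class
  (endo_lift_neq0 f (hcoord_neq0 (iter n (endo_map f) x))).
exists (b * c ^+ d); first by rewrite mulf_neq0// expf_neq0.
by rewrite !iterS [LHS]bE IHn endo_lift_homogeneous scalerA.
Qed.

(** The open sets of the quotient topology are given by scale-invariant
   conditions on the homogeneous coordinates that are open on nonzero vectors.
   By scale invariance such a condition does not depend on the representative
   chosen by hcoord. *)
Lemma open_hcoord (P : set 'rV[C]_k.+1) :
  (forall (c : C) z, c != 0 -> P z -> P (c *: z)) ->
  (forall z, z != 0 -> P z ->
    exists2 r : R, 0 < r & forall w, nrm (w - z) < r -> P w) ->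
  open [set x : CPk | P (hcoord x)].
Proof.
move=> PZ Popen.
have PE : (\pi_CPk : nzvec R k -> CPk) @^-1` [set x : CPk | P (hcoord x)] =
    (@nzval R k) @^-1` (P `&` [set z | z != 0]).
  apply/seteqP; split => z /=.
    have z0 : nzval z != 0 by exact: set_mem (svalP z).
    have [c c0 cE] := hcoord_proj_class z0.
    have -> : \pi z = proj_class (mk_nzvec z0).
      by rewrite mk_nzvec_val.
    rewrite cE => /(PZ c^-1); rewrite scalerA mulVf// scale1r invr_eq0.
    by move=> /(_ c0).
  have z0 : nzval z != 0 by exact: set_mem (svalP z).
  have [c c0 cE] := hcoord_proj_class z0.
  have -> : \pi z = proj_class (mk_nzvec z0).
    by rewrite mk_nzvec_val.
  by rewrite cE => -[Pz _]; exact: PZ.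
rewrite /open/= /quotient_open PE.
exists (P `&` [set z | z != 0]) => //.
rewrite openE => z /= [Pz z0]; apply/nbhs_nrmP.
have [r r0 rP] := Popen z z0 Pz.
exists (Num.min r (nrm z)); first by rewrite lt_min r0 nrm_gt0.
move=> w; rewrite lt_min => /andP[wr wz]; split; first exact: rP.
apply/eqP => w0; move: wz; rewrite w0 sub0r nrmN ltxx//.
Qed.

(** Neighbourhoods of x are tested with arbitrary representatives of the nearby
   points. *)
Lemma open_near (U : set CPk) (x : CPk) : open U -> U x ->
  exists2 r : R, 0 < r & forall y (c : C), c != 0 ->
    nrm (c *: hcoord y - hcoord x) < r -> U y.
Proof.
move=> [A oA AE] Ux.
have Ax : A (hcoord x).
  have : ((\pi_CPk : nzvec R k -> CPk) @^-1` U) (repr x) by rewrite /= reprK.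
  by rewrite -AE.
move: oA; rewrite openE => /(_ _ Ax)/nbhs_nrmP[r r0 rP].
exists r => // y c c0 /rP Ay.
have y0 : c *: hcoord y != 0 by rewrite scaler_eq0 negb_or c0 hcoord_neq0.
have Uc : U (proj_class (mk_nzvec y0)).
  have : (set_val @^-1` A) (mk_nzvec y0) by [].
  by rewrite AE.
suff <- : proj_class (mk_nzvec y0) = y by [].
rewrite -[RHS]proj_class_hcoord.
by apply/esym/proj_classP; exists c.
Qed.

Lemma open_proj (U : set CPk) z : open U ->
  forall z0 : z != 0, U (proj_class (mk_nzvec z0)) ->
  exists2 r : R, 0 < r & forall w (w0 : w != 0),
    nrm (w - z) < r -> U (proj_class (mk_nzvec w0)).
Proof.
move=> oU z0 /(open_near oU)[r r0 rP].
have [c c0 cE] := hcoord_proj_class z0; have c0' : 0 < cabs c by rewrite cabs_gt0.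
exists (r / cabs c); first by rewrite divr_gt0.
move=> w w0 wz; have [b b0 bE] := hcoord_proj_class w0.
apply: (rP _ (c / b)); first by rewrite mulf_neq0// invr_eq0.
rewrite bE cE scalerA divfK// -scalerBr nrmZ.
by rewrite ltr_pdivlMr// mulrC in wz.
Qed.

Lemma endo_map_measurable d (f : endo C k d) :
  measurable_fun setT (endo_map f : CPk -> CPk).
Proof.
apply: (@measurability _ _ _ _ _ _ (@open CPk)) => // _ [U oU <-].
rewrite setTI; apply: sub_sigma_algebra.
pose P (z : 'rV[C]_k.+1) := exists z0 : endo_lift f z != 0,
  U (proj_class (mk_nzvec z0)).
have -> : endo_map f @^-1` U = [set x | P (hcoord x)].
  apply/seteqP; split => x /=; first by exists (endo_lift_neq0 f (hcoord_neq0 x)).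
  by move=> [z0 Uz]; rewrite /endo_map (bool_irrelevance (endo_lift_neq0 _ _) z0).
apply: open_hcoord => [c z c0 [z0 Uz]|z z0 [Fz0 UFz]].
  have cz0 : endo_lift f (c *: z) != 0.
    by rewrite endo_lift_homogeneous scaler_eq0 negb_or expf_neq0.
  exists cz0; suff <- : proj_class (mk_nzvec z0) = proj_class (mk_nzvec cz0) by [].
  apply/proj_classP; exists (c ^+ d); first by rewrite expf_neq0.
  exact: endo_lift_homogeneous.
have [r r0 rP] := open_proj oU UFz.
have [K K0 KP] := uniform_taylor_expansion (nrm z + 1) (endo_lift_uniform_taylor f).
exists (Num.min (Num.min 1 (nrm z)) (r / K)).
  by rewrite !lt_min ltr01 nrm_gt0 z0 divr_gt0.
move=> w; rewrite !lt_min => /andP[/andP[w1 wz] wr].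
have w0 : w != 0.
  by apply/eqP => w0; move: wz; rewrite w0 sub0r nrmN ltxx.
exists (endo_lift_neq0 f w0); apply: rP.
have [||_ le1 _] := KP z w; first by rewrite lerDl.
  by rewrite (le_trans (nrm_triangle w z))// lerD2l ltW.
by rewrite (le_lt_trans le1)// mulrC -ltr_pdivlMr.
Qed.

End ProjectiveTopology.

(** * Minors and chordal distance *)

Section Wedge.
Variables (R : realType) (k : nat).
Local Notation C := (cplx R).
Implicit Types a b z w : 'rV[C]_k.+1.

(** The largest 2 x 2 minor of the matrix with rows z and w, in modulus. *)
Definition wedge z w : R := \big[Num.max/0]_(p : 'I_k.+1 * 'I_k.+1)
  cabs (z ord0 p.1 * w ord0 p.2 - z ord0 p.2 * w ord0 p.1).

(** A chordal distance between the points with homogeneous coordinates z and w; it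
   is invariant under scaling of both vectors. *)
Definition sdist z w : R := wedge z w / (nrm z * nrm w).

Lemma wedge_ge0 z w : 0 <= wedge z w.
Proof. exact: bigmax_ge_id. Qed.

Lemma wedge_ge z w i j :
  cabs (z ord0 i * w ord0 j - z ord0 j * w ord0 i) <= wedge z w.
Proof.
exact: (le_bigmax _ (fun p : 'I_k.+1 * 'I_k.+1 =>
  cabs (z ord0 p.1 * w ord0 p.2 - z ord0 p.2 * w ord0 p.1)) (i, j)).
Qed.

Lemma wedge_leP z w (c : R) : 0 <= c ->
  (forall i j, cabs (z ord0 i * w ord0 j - z ord0 j * w ord0 i) <= c) ->
  wedge z w <= c.
Proof. by move=> c0 zw; apply/bigmax_leP; split => // -[i j] _. Qed.

Lemma wedgeDr z w w' : wedge z (w + w') <= wedge z w + wedge z w'.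
Proof.
apply: wedge_leP => [|i j]; first by rewrite addr_ge0 ?wedge_ge0.
rewrite !mxE; have le1 := wedge_ge z w i j; have le2 := wedge_ge z w' i j.
apply: le_trans (lerD le1 le2); apply: le_trans (cabsD _ _).
by rewrite le_eqVlt; apply/orP; left; apply/eqP; congr cabs; ring.
Qed.

Lemma wedge_addl z w (c : C) : wedge z (w + c *: z) = wedge z w.
Proof.
by apply: eq_bigr => -[i j] _ /=; rewrite !mxE; congr cabs; ring.
Qed.

Lemma wedgeZ z w (b c : C) : wedge (b *: z) (c *: w) = cabs b * cabs c * wedge z w.
Proof.
have le_wedge z1 w1 (b1 c1 : C) :
    wedge (b1 *: z1) (c1 *: w1) <= cabs b1 * cabs c1 * wedge z1 w1.
  apply: wedge_leP => [|i j]; first by rewrite !mulr_ge0 ?cabs_ge0 ?wedge_ge0.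
  rewrite !mxE (_ : _ - _ = b1 * c1 *
    (z1 ord0 i * w1 ord0 j - z1 ord0 j * w1 ord0 i)); last by ring.
  by rewrite !cabsM ler_wpM2l ?wedge_ge// mulr_ge0 ?cabs_ge0.
apply/le_anti/andP; split => //.
have [->|b0] := eqVneq b 0; first by rewrite cabs0 !mul0r wedge_ge0.
have [->|c0] := eqVneq c 0; first by rewrite cabs0 mulr0 mul0r wedge_ge0.
have := le_wedge (b *: z) (c *: w) b^-1 c^-1.
rewrite !scalerA !mulVf// !scale1r !cabsV -invfM mulrC ler_pdivlMr.
  by rewrite mulrC.
by rewrite mulr_gt0 ?cabs_gt0.
Qed.

Lemma wedgeZr z w (c : C) : wedge z (c *: w) = cabs c * wedge z w.
Proof. by rewrite -{1}(scale1r z) wedgeZ cabs1 mul1r. Qed.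

Lemma wedge_le z w : wedge z w <= 2 * (nrm z * nrm w).
Proof.
apply: wedge_leP => [|i j]; first by rewrite !mulr_ge0 ?nrm_ge0.
rewrite (le_trans (cabsB _ _))// !cabsM mulrDl mul1r.
by rewrite lerD// ler_pM ?cabs_ge0 ?nrm_ge.
Qed.

Lemma wedge_sum z (I : finType) (w : I -> 'rV[C]_k.+1) (P : pred I) :
  wedge z (\sum_(i | P i) w i) <= \sum_(i | P i) wedge z (w i).
Proof.
elim/big_ind2: _ => [|x u y v xu yv|//].
  by rewrite -(scale0r 0) wedgeZr cabs0 mul0r.
by rewrite (le_trans (wedgeDr _ _ _))// lerD.
Qed.

Lemma sdistZ z w (b c : C) : b != 0 -> c != 0 ->
  sdist (b *: z) (c *: w) = sdist z w.
Proof.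
move=> b0 c0; rewrite /sdist wedgeZ !nrmZ mulrACA -mulf_div divff ?mul1r//.
by rewrite mulf_neq0// cabs_eq0.
Qed.

Lemma sdistZl z w (b : C) : b != 0 -> sdist (b *: z) w = sdist z w.
Proof. by move=> b0; rewrite -[in LHS](scale1r w) sdistZ// oner_neq0. Qed.

Lemma sdistZr z w (c : C) : c != 0 -> sdist z (c *: w) = sdist z w.
Proof. by move=> c0; rewrite -[in LHS](scale1r z) sdistZ// oner_neq0. Qed.

Lemma sdist_ge0 z w : 0 <= sdist z w.
Proof. by rewrite divr_ge0 ?wedge_ge0// mulr_ge0 ?nrm_ge0. Qed.

Lemma sdist_le2 z w : sdist z w <= 2.
Proof.
have [->|z0] := eqVneq z 0; first by rewrite /sdist nrm0 mul0r invr0 mulr0.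
have [->|w0] := eqVneq w 0; first by rewrite /sdist nrm0 mulr0 invr0 mulr0.
by rewrite ler_pdivrMr ?mulr_gt0 ?nrm_gt0// wedge_le.
Qed.

Lemma sdist_le_nrmB z w (c e : R) : 0 < c -> c <= nrm w -> nrm (w - z) <= e ->
  sdist z w <= 2 * e / c.
Proof.
move=> c0 cw wze; have w0 : 0 < nrm w by exact: lt_le_trans cw.
have e0 : 0 <= e by rewrite (le_trans _ wze)// nrm_ge0.
have [->|z0] := eqVneq z 0.
  by rewrite /sdist nrm0 mul0r invr0 mulr0 !mulr_ge0// invr_ge0 ltW.
have z0' : 0 < nrm z by rewrite nrm_gt0.
rewrite /sdist ler_pdivrMr ?mulr_gt0//.
rewrite -{1}(subrK z w) -[X in _ + X]scale1r wedge_addl.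
rewrite (le_trans (wedge_le _ _))//.
have -> : 2 * e / c * (nrm z * nrm w) = 2 * (nrm z * (e * (nrm w / c))) by ring.
rewrite ler_pM2l// ler_pM2l// (le_trans wze)// ler_peMr//.
by rewrite ler_pdivlMr// mul1r.
Qed.

Lemma normalize z : z != 0 -> exists2 c : C, c != 0 & nrm (c *: z) = 1.
Proof.
move=> z0; have [i zi] := nrm_attained z0.
have zi0 : z ord0 i != 0 by rewrite -cabs_gt0 -zi nrm_gt0.
exists (z ord0 i)^-1; first by rewrite invr_eq0.
by rewrite nrmZ cabsV -zi mulVf// nrm_eq0.
Qed.

Section Hermitian.

Lemma hermitian_sum z :
  complex.Re (spectral.dotmx z z) = \sum_i cabs (z ord0 i) ^+ 2.
Proof.
have -> : spectral.dotmx z z = \sum_i z ord0 i * (z ord0 i)^*.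
  rewrite spectral.dotmxE !mxE; apply: eq_bigr => i _; rewrite !mxE//.
elim/big_rec2: _ => [//|i x y _ xy].
rewrite raddfD/= xy; congr (_ + _); case: (z ord0 i) => u v /=.
by rewrite sqr_sqrtr ?addr_ge0 ?sqr_ge0// mulrN opprK !expr2.
Qed.

Lemma nrm_le_hermitian z : nrm z <= hermitian_norm z.
Proof.
apply: nrm_le => [|i]; first exact: sqrtr_ge0.
rewrite /hermitian_norm hermitian_sum -[leLHS]ger0_norm ?cabs_ge0//.
rewrite -sqrtr_sqr ler_sqrt ?sumr_ge0//; last by move=> j _; exact: sqr_ge0.
by rewrite (bigD1 i)//= lerDl sumr_ge0// => j _; exact: sqr_ge0.
Qed.

Lemma hermitian_le_nrm z : hermitian_norm z ^+ 2 <= k.+1%:R * nrm z ^+ 2.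
Proof.
rewrite /hermitian_norm hermitian_sum sqr_sqrtr; last first.
  by rewrite sumr_ge0// => j _; exact: sqr_ge0.
rewrite (@le_trans _ _ (\sum_(i < k.+1) nrm z ^+ 2))//.
  by apply: ler_sum => i _; rewrite lerXn2r ?nnegrE ?cabs_ge0 ?nrm_ge0// nrm_ge.
by rewrite sumr_const card_ord -[leLHS]mulr_natl.
Qed.

(** The component of v along z does not contribute to the minors. *)
Lemma wedge_fubini_study z v : z != 0 ->
  wedge z v <= 2 * k.+1%:R * nrm z ^+ 2 * fubini_study_norm z v.
Proof.
move=> z0; rewrite /fubini_study_norm.
set v' := v - _; have -> : wedge z v = wedge z v'.
  by rewrite /v' -scaleNr wedge_addl.
have h0 : 0 < hermitian_norm z.
  by rewrite (lt_le_trans _ (nrm_le_hermitian z))// nrm_gt0.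
rewrite (le_trans (wedge_le _ _))//.
have -> : 2 * k.+1%:R * nrm z ^+ 2 * (hermitian_norm v' / hermitian_norm z) =
    2 * ((k.+1%:R * nrm z ^+ 2) / hermitian_norm z * hermitian_norm v').
  by rewrite !mulrA [_ / hermitian_norm z * hermitian_norm v']mulrAC.
rewrite ler_pM2l// ler_pM ?nrm_ge0 ?nrm_le_hermitian//.
rewrite ler_pdivlMr// (le_trans _ (hermitian_le_nrm z))// expr2.
by rewrite ler_pM2r// nrm_le_hermitian.
Qed.

End Hermitian.
End Wedge.

(** * Distortion of the chordal distance *)

Section Distortion.
Variables (R : realType) (k d : nat) (f : endo (cplx R) k d).
Local Notation C := (cplx R).
Local Notation F := (endo_lift f).

(** Close points have close representatives of norm between 1 and 2, and on these
   the lift is Lipschitz and bounded away from 0.  Distant points are dealt with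
   by the upper bound 2 of the distance. *)
Lemma lift_lipschitz : exists2 M : R, 1 <= M &
  forall z w : 'rV[C]_k.+1, z != 0 -> w != 0 -> sdist (F z) (F w) <= M * sdist z w.
Proof.
have [c c0 cP] := endo_lift_lower_bound f.
have [K K0 KP] := uniform_taylor_expansion 2 (endo_lift_uniform_taylor f).
have Kc0 : 0 < K / c by rewrite divr_gt0.
exists (4 + 4 * (K / c)); first lra.
move=> z w z0 w0.
wlog z1 : z z0 / nrm z = 1.
  move=> wh; have [a a0 az] := normalize z0.
  have := wh (a *: z); rewrite scaler_eq0 negb_or a0 z0 => /(_ isT az).
  by rewrite endo_lift_homogeneous !sdistZl ?expf_neq0.
wlog w1 : w w0 / nrm w = 1.
  move=> wh; have [a a0 aw] := normalize w0.
  have := wh (a *: w); rewrite scaler_eq0 negb_or a0 w0 => /(_ isT aw).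
  by rewrite endo_lift_homogeneous !sdistZr ?expf_neq0.
have sE : sdist z w = wedge z w by rewrite /sdist z1 w1 mulr1 divr1.
have [s_big|s_small] := ltP (2^-1) (sdist z w).
  rewrite (le_trans (sdist_le2 _ _))//.
  have : 0 <= 4 * (K / c) * sdist z w by rewrite mulr_ge0 ?sdist_ge0// ltW// mulr_gt0.
  lra.
set s := sdist z w in s_small sE *.
have s0 : 0 <= s by exact: sdist_ge0.
clearbody s.
have [i zi] := nrm_attained z0; have [j wj] := nrm_attained w0.
have wi : 2^-1 <= cabs (w ord0 i).
  have := wedge_ge z w i j; rewrite -sE => le_s.
  have : cabs (z ord0 i * w ord0 j) <= s + cabs (z ord0 j * w ord0 i).
    rewrite -{1}(subrK (z ord0 j * w ord0 i) (z ord0 i * w ord0 j)).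
    by rewrite (le_trans (cabsD _ _))// lerD2r.
  rewrite !cabsM -zi -wj z1 w1 mulr1 => le1.
  have : cabs (z ord0 j) * cabs (w ord0 i) <= cabs (w ord0 i).
    by rewrite ler_piMl ?cabs_ge0// -z1 nrm_ge.
  lra.
have wi0' : 0 < cabs (w ord0 i) by rewrite (lt_le_trans _ wi).
have wi0 : w ord0 i != 0 by rewrite -cabs_gt0.
have zi0 : z ord0 i != 0 by rewrite -cabs_gt0 -zi z1.
(* This multiple of w has the same i-th coordinate as z. *)
pose a := z ord0 i / w ord0 i; have a0 : a != 0 by rewrite mulf_neq0 ?invr_eq0.
have aE : cabs a = (cabs (w ord0 i))^-1 by rewrite cabsM cabsV -zi z1 mul1r.
have aw_z : nrm (a *: w - z) <= 2 * s.
  apply: nrm_le => [|l]; first by rewrite mulr_ge0.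
  rewrite !mxE (_ : _ + _ = (z ord0 i * w ord0 l - z ord0 l * w ord0 i) / w ord0 i).
    rewrite cabsM cabsV ler_pdivrMr//.
    rewrite (le_trans (wedge_ge z w i l))// -sE.
    by rewrite mulrAC ler_peMl//; lra.
  by rewrite /a mulrBl mulrAC mulfK.
have aw1 : 1 <= nrm (a *: w).
  by rewrite nrmZ w1 mulr1 aE invf_ge1// -w1 nrm_ge.
have aw2 : nrm (a *: w) <= 2.
  rewrite nrmZ w1 mulr1 aE -[leRHS]invrK lef_pV2 ?posrE//.
clearbody a.
have FwE : sdist (F z) (F w) = sdist (F z) (F (a *: w)).
  by rewrite endo_lift_homogeneous sdistZr ?expf_neq0.
have [||FzK le1 _] := KP z (a *: w) => //; first by rewrite z1; lra.
have Faw : c <= nrm (F (a *: w)).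
  by rewrite (le_trans _ (cP _))// ler_peMr ?(ltW c0)// exprn_ege1.
rewrite FwE (le_trans (sdist_le_nrmB c0 Faw (le_trans le1 (ler_wpM2l (ltW K0) aw_z))))//.
have -> : 2 * (K * (2 * s)) / c = 4 * (K / c) * s by ring.
by rewrite [leRHS]mulrDl lerDr mulr_ge0.
Qed.

Lemma iter_lift_lipschitz : exists2 M : R, 1 <= M &
  forall n (z w : 'rV[C]_k.+1), z != 0 -> w != 0 ->
    sdist (iter n F z) (iter n F w) <= M ^+ n * sdist z w.
Proof.
have [M M1 MP] := lift_lipschitz; exists M => // n z w z0 w0.
elim: n => [|n IHn]; first by rewrite expr0 mul1r.
rewrite !iterS (le_trans (MP _ _ _ _)) ?iter_lift_neq0//.
by rewrite exprS -mulrA ler_wpM2l// (le_trans _ M1).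
Qed.

(** To first order, f^n expands the distance from the point of z by the norm of
   its differential; the directions e_j with j <> i suffice because z and w lie
   in the same affine chart.  For r small in terms of n the quadratic remainder
   is absorbed in the summand 1. *)
Lemma iter_lift_expansion n : exists2 delta : R, 0 < delta &
  forall (z w : 'rV[C]_k.+1) i (r : R), nrm z = 1 -> nrm w = 1 ->
    z ord0 i = w ord0 i -> nrm (w - z) <= r -> r <= delta ->
  sdist (iter n F z) (iter n F w) <=
    (2 * (\sum_(j < k.+1 | j != i)
       wedge (iter n F z) ('d (iter n F) z (delta_mx ord0 j)) /
         nrm (iter n F z) ^+ 2) + 1) * r.
Proof.
set G := iter n F.
have G2 : uniform_taylor G by apply: uniform_taylor_iter; exact: endo_lift_uniform_taylor.
have [K K0 KP] := uniform_taylor_expansion 1 G2.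
have [c c0 cP] := iter_lift_lower_bound f n.
exists (c / (4 * K)); first by rewrite divr_gt0// mulr_gt0.
move=> z w i r z1 w1 zwi wzr; rewrite ler_pdivlMr ?mulr_gt0// => rK.
have r0 : 0 <= r by rewrite (le_trans _ wzr)// nrm_ge0.
have [||GzK le1 le2] := KP z w; rewrite ?z1 ?w1//.
have Gz : c <= nrm (G z) by exact: cP.
have Gz0 : 0 < nrm (G z) by exact: lt_le_trans Gz.
have Gw : nrm (G z) <= 2 * nrm (G w).
  have := nrm_triangle (G z) (G w); rewrite nrmBC => le3.
  have : K * nrm (w - z) <= K * r by rewrite ler_pM2l.
  lra.
have Gw0 : 0 < nrm (G w) by lra.
set S := \sum_(j < k.+1 | _) _.
have S0 : 0 <= S.
  by apply: sumr_ge0 => j _; rewrite divr_ge0 ?wedge_ge0// exprn_ge0// nrm_ge0.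
rewrite /sdist ler_pdivrMr ?mulr_gt0//.
have wedge_diff : wedge (G z) ('d G z (w - z)) <= S * r * nrm (G z) ^+ 2.
  rewrite [w - z]row_sum_delta linear_sum (bigD1 i)//=.
  rewrite [X in X + _](_ : _ = 0); last first.
    by rewrite row_subE zwi subrr scale0r linear0.
  rewrite add0r (le_trans (wedge_sum _ _ _))//.
  rewrite -mulrA mulr_suml; apply: ler_sum => j _.
  rewrite linearZ wedgeZr mulrC mulrA mulrAC divfK; last by rewrite expf_neq0// gt_eqF.
  by rewrite ler_wpM2l ?wedge_ge0// (le_trans _ wzr)// nrm_ge.
rewrite -{1}(subrK (G z) (G w)) -[X in _ + X]scale1r wedge_addl.
rewrite -(subrK ('d G z (w - z)) (G w - G z)) addrC.
rewrite (le_trans (wedgeDr _ _ _))//.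
have wedge_rem : wedge (G z) (G w - G z - 'd G z (w - z)) <=
    nrm (G z) * (c / 2) * r.
  rewrite (le_trans (wedge_le _ _))// mulrCA -mulrA ler_pM2l//.
  have le4 : K * nrm (w - z) ^+ 2 <= K * (r * r).
    by rewrite ler_pM2l// expr2 ler_pM ?nrm_ge0.
  have : r * (4 * K) * r <= c * r by rewrite ler_wpM2r.
  lra.
rewrite (le_trans (lerD wedge_diff wedge_rem))//.
have p1 : S * r * nrm (G z) ^+ 2 <= 2 * S * r * (nrm (G z) * nrm (G w)).
  rewrite expr2 mulrA.
  have -> : 2 * S * r * (nrm (G z) * nrm (G w)) =
    S * r * nrm (G z) * (2 * nrm (G w)) by ring.
  by rewrite ler_wpM2l// !mulr_ge0// ltW.
have p2 : nrm (G z) * (c / 2) * r <= r * (nrm (G z) * nrm (G w)).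
  have -> : r * (nrm (G z) * nrm (G w)) = nrm (G z) * nrm (G w) * r by ring.
  by rewrite ler_wpM2r// ler_pM2l//; lra.
lra.
Qed.

(** The summands above, in the metric of Fubini and Study at the given
   representative y of the point. *)
Lemma wedge_diff_iter_norm n (y v : 'rV[C]_k.+1) (c : C) :
  y != 0 -> c != 0 -> nrm (c *: y) = 1 ->
  wedge (iter n F (c *: y)) ('d (iter n F) (c *: y) v) /
     nrm (iter n F (c *: y)) ^+ 2 <=
  2 * k.+1%:R * nrm y * diff_iter_norm f n y v.
Proof.
move=> y0 c0 cy1; set G := iter n F.
have G2 : uniform_taylor G by apply: uniform_taylor_iter; exact: endo_lift_uniform_taylor.
have Gc u : G (c *: u) = c ^+ (d ^ n) *: G u by exact: iter_lift_homogeneous.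
have dE := diff_homogeneous y v G2 c0 Gc.
have -> : wedge (G (c *: y)) ('d G (c *: y) v) =
    wedge (G (c *: y)) ((c ^+ (d ^ n) / c) *: 'd G y v).
  exact: (congr1 (wedge (G (c *: y))) dE).
rewrite Gc wedgeZ nrmZ.
set D := cabs (c ^+ (d ^ n)).
have D0 : 0 < D by rewrite cabs_gt0 expf_neq0.
have Gy0 : 0 < nrm (G y) by rewrite nrm_gt0 iter_lift_neq0.
have cE : (cabs c)^-1 = nrm y.
  move: cy1; rewrite nrmZ => cy1; apply: (mulfI (_ : cabs c != 0)).
    by rewrite cabs_eq0.
  by rewrite cy1 divff// cabs_eq0.
rewrite cabsM cabsV cE -/D ler_pdivrMr; last by rewrite exprn_gt0// mulr_gt0.
have := wedge_fubini_study ('d G y v) (iter_lift_neq0 f n y0).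
rewrite -/G -[fubini_study_norm _ _]/(diff_iter_norm f n y v) => le1.
have -> : D * (D * nrm y) * wedge (G y) ('d G y v) =
  D ^+ 2 * nrm y * wedge (G y) ('d G y v) by ring.
have -> : 2 * k.+1%:R * nrm y * diff_iter_norm f n y v * (D * nrm (G y)) ^+ 2 =
  D ^+ 2 * nrm y * (2 * k.+1%:R * nrm (G y) ^+ 2 * diff_iter_norm f n y v) by ring.
by rewrite ler_wpM2l// mulr_ge0 ?nrm_ge0// exprn_ge0// ltW.
Qed.

End Distortion.

(** * Grid cells of projective space *)

Section Cells.
Variables (R : realType) (k : nat).
Local Notation C := (cplx R).
Implicit Types a z w : 'rV[C]_k.+1.

Definition dominant z : {set 'I_k.+1} :=
  [set i | cabs (z ord0 i) == nrm z]%SET.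

Definition chart z : 'I_k.+1 := odflt ord0 [pick i in dominant z].

Lemma chartP z : z != 0 -> cabs (z ord0 (chart z)) = nrm z.
Proof.
move=> z0; rewrite /chart; case: pickP => [i|none]; first by rewrite inE => /eqP.
have [i zi] := nrm_attained z0; have := none i.
by rewrite inE zi eqxx.
Qed.

Lemma chart_neq0 z : z != 0 -> z ord0 (chart z) != 0.
Proof. by move=> z0; rewrite -cabs_gt0 chartP// nrm_gt0. Qed.

Definition re_or_im (b : bool) (c : C) : R := if b then complex.Re c else complex.Im c.

Lemma re_or_im_le b c : `|re_or_im b c| <= cabs c.
Proof. by case: b; [exact: cabs_Re|exact: cabs_Im]. Qed.

Lemma re_or_imB b (c c' : C) : re_or_im b (c - c') = re_or_im b c - re_or_im b c'.
Proof. by case: b; rewrite /re_or_im raddfB. Qed.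

Definition affine_coord (i : 'I_k.+1) z (p : 'I_k * bool) : R :=
  re_or_im p.2 (z ord0 (lift i p.1) / z ord0 i).

Definition cell_type (q : nat) : finType :=
  ('I_k.+1 * {ffun 'I_k * bool -> 'I_(2 * q).+1})%type.

(** In the affine chart of a coordinate of largest modulus the other coordinates
   lie in the closed unit disc; their real and imaginary parts are cut into
   intervals of length 1/q. *)
Definition cell (q : nat) z : cell_type q :=
  (chart z,
   [ffun p => inord (Num.truncn (q%:R * (affine_coord (chart z) z p + 1)))]).

Lemma affine_coord_le z p : z != 0 -> `|affine_coord (chart z) z p| <= 1.
Proof.
move=> z0; rewrite (le_trans (re_or_im_le _ _))// cabsM cabsV chartP//.
by rewrite ler_pdivrMr ?nrm_gt0// mul1r nrm_ge.
Qed.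

Lemma affine_scaled_ge0 q z p : z != 0 ->
  0 <= q%:R * (affine_coord (chart z) z p + 1).
Proof.
move=> z0; rewrite mulr_ge0//.
by have := affine_coord_le p z0; rewrite ler_norml => /andP[]; lra.
Qed.

Lemma cell_val q z p : z != 0 ->
  nat_of_ord ((cell q z).2 p) =
    Num.truncn (q%:R * (affine_coord (chart z) z p + 1)).
Proof.
move=> z0; rewrite ffunE inordK// ltnS.
have := truncn_itv (affine_scaled_ge0 q p z0) => /andP[le1 _].
rewrite -(ler_nat R) (le_trans le1)// natrM mulrC ler_wpM2r//.
by have := affine_coord_le p z0; rewrite ler_norml => /andP[]; lra.
Qed.

Lemma cell_val_itv q z p : z != 0 ->
  (nat_of_ord ((cell q z).2 p))%:R <= q%:R * (affine_coord (chart z) z p + 1) <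
    (nat_of_ord ((cell q z).2 p)).+1%:R.
Proof. by move=> z0; rewrite cell_val// truncn_itv// affine_scaled_ge0. Qed.

Definition affine z : 'rV[C]_k.+1 := (z ord0 (chart z))^-1 *: z.

Lemma affineE z j : affine z ord0 j = z ord0 j / z ord0 (chart z).
Proof. by rewrite mxE mulrC. Qed.

Lemma affine_chart z : z != 0 -> affine z ord0 (chart z) = 1.
Proof. by move=> z0; rewrite affineE divff// chart_neq0. Qed.

Lemma nrm_affine z : z != 0 -> nrm (affine z) = 1.
Proof. by move=> z0; rewrite nrmZ cabsV chartP// mulVf// nrm_eq0. Qed.

Lemma cell_close q z w : (0 < q)%N -> z != 0 -> w != 0 -> cell q z = cell q w ->
  chart z = chart w /\ nrm (affine w - affine z) <= 2 / q%:R.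
Proof.
move=> q0 z0 w0 zw; have czw : chart z = chart w by case: zw.
have q0' : 0 < q%:R :> R by rewrite ltr0n.
split=> //; apply: nrm_le => [|j]; first by rewrite divr_ge0.
rewrite row_subE; have [->|jz] := eqVneq j (chart z).
  by rewrite {1}czw !affine_chart// subrr cabs0 divr_ge0.
have [l jl] : exists l, j = lift (chart z) l.
  by case: (unliftP (chart z) j) jz => [l ->|->]; [exists l|rewrite eqxx].
have part_lt b : `|re_or_im b (affine w ord0 j - affine z ord0 j)| <= q%:R^-1.
  have := cell_val_itv q (l, b) z0; have := cell_val_itv q (l, b) w0.
  rewrite -zw /affine_coord/= -czw -jl re_or_imB !affineE -czw.
  set m := nat_of_ord _; set x := re_or_im b (w _ _ / _); set y := re_or_im b (z _ _ / _).
  rewrite -natr1 => /andP[le1 lt1] /andP[le2 lt2].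
  rewrite -(ler_pM2l q0') divff ?gt_eqF// -{1}(ger0_norm (ltW q0')) -normrM.
  by rewrite ler_norml; lra.
rewrite (le_trans (cabs_le_ReIm _))// mulrDl mul1r.
by rewrite lerD//; [exact: (part_lt true)|exact: (part_lt false)].
Qed.

(** A bound, independent of the mesh, on the number of cells that meet a set of
   diameter comparable to the mesh; each complex coordinate of an affine chart
   contributes a factor 2 to the exponent. *)
Lemma card_close_cells q (Theta : nat) a (A : {set cell_type q}) :
  (0 < q)%N -> (2 * Theta <= q)%N -> nrm a = 1 ->
  (forall b, b \in A -> exists w,
    [/\ w != 0, cell q w = b & q%:R * sdist a w <= Theta%:R]) ->
  (#|A| <= k.+1 * (4 * Theta).+1 ^ (2 * k))%N.
Proof.
move=> q0 Tq a1 A_close; have q0' : 0 < q%:R :> R by rewrite ltr0n.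
have a0 : a != 0 by rewrite -nrm_gt0 a1.
pose m (i : 'I_k.+1) p : int := Num.floor (q%:R * (affine_coord i a p + 1)).
(* As a is close to w, its coordinate in the chart of w has modulus at least
   1/2, so that a and w can be compared in this chart. *)
have near_a (w : 'rV[C]_k.+1) p : w != 0 -> q%:R * sdist a w <= Theta%:R ->
    `|q%:R * (affine_coord (chart w) w p + 1) -
      q%:R * (affine_coord (chart w) a p + 1)| <= (2 * Theta)%:R.
  move=> w0 dist_aw; set i := chart w.
  have sE : sdist a w = wedge a (affine w).
    rewrite -(sdistZr a w (_ : (w ord0 i)^-1 != 0)) ?invr_eq0 ?chart_neq0//.
    by rewrite /sdist nrm_affine// a1 mulr1 divr1.
  have wi1 : affine w ord0 i = 1 by exact: affine_chart.
  have le_wedge l : cabs (a ord0 i * affine w ord0 l - a ord0 l) <= sdist a w.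
    by have := wedge_ge a (affine w) i l; rewrite wi1 mulr1 -sE.
  have s_half : sdist a w <= 2^-1.
    rewrite -(ler_pM2l q0') (le_trans dist_aw)// ler_pdivlMr// mulrC.
    by rewrite -natrM ler_nat.
  have ai : 2^-1 <= cabs (a ord0 i).
    have [j aj] := nrm_attained a0; have := le_wedge j.
    have : cabs (a ord0 j) <= cabs (a ord0 i * affine w ord0 j) +
        cabs (a ord0 i * affine w ord0 j - a ord0 j).
      rewrite -{1}[a ord0 j](subKr (a ord0 i * affine w ord0 j)).
      exact: cabsB.
    rewrite -aj a1 cabsM.
    have : cabs (a ord0 i) * cabs (affine w ord0 j) <= cabs (a ord0 i).
      by rewrite ler_piMr ?cabs_ge0// -(nrm_affine w0) nrm_ge.
    lra.
  have ai0' : 0 < cabs (a ord0 i) by rewrite (lt_le_trans _ ai).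
  have ai0 : a ord0 i != 0 by rewrite -cabs_gt0.
  have le1 : cabs (w ord0 (lift i p.1) / w ord0 i - a ord0 (lift i p.1) / a ord0 i)
      <= 2 * sdist a w.
    rewrite -affineE -/i.
    have -> : affine w ord0 (lift i p.1) - a ord0 (lift i p.1) / a ord0 i =
      (a ord0 i * affine w ord0 (lift i p.1) - a ord0 (lift i p.1)) / a ord0 i.
      by rewrite mulrBl mulrAC divff// mul1r.
    rewrite cabsM cabsV ler_pdivrMr// (le_trans (le_wedge _))//.
    have := sdist_ge0 a w => s0.
    by rewrite mulrAC ler_peMl//; lra.
  rewrite -mulrBr normrM (ger0_norm (ltW q0')) opprD addrACA subrr addr0.
  rewrite /affine_coord -re_or_imB.
  rewrite (le_trans (ler_wpM2l (ltW q0') (le_trans (re_or_im_le _ _) le1)))//.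
  by rewrite mulrCA natrM ler_pM2l.
pose code (b : cell_type q) :
    'I_k.+1 * {ffun 'I_k * bool -> 'I_(4 * Theta).+1} :=
  (b.1, [ffun p => inord (absz (Posz (b.2 p) - m b.1 p + Posz (2 * Theta)))]).
have code_range b p : b \in A ->
    0 <= Posz (b.2 p) - m b.1 p + Posz (2 * Theta) <= Posz (4 * Theta).
  move=> /A_close[w [w0 <- dist_aw]].
  have := near_a w p w0 dist_aw; have := cell_val_itv q p w0.
  rewrite /= /m; set x := q%:R * _; set y := q%:R * (_ + _).
  set v := nat_of_ord _; rewrite -natr1 => /andP[le1 lt1].
  rewrite ler_norml => /andP[le2 le3].
  have := floor_itv y; set M := Num.floor y; rewrite intrD1 => /andP[le4 lt4].
  have T2 : (2 * Theta)%:R = (Posz (2 * Theta))%:~R :> R by [].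
  have vR : v%:R = (Posz v)%:~R :> R by [].
  have lt5 : M < Posz v + Posz (2 * Theta) + 1.
    by rewrite -(ltr_int R) !intrD -vR -T2 mulr1z; lra.
  have lt6 : Posz v < M + 1 + Posz (2 * Theta).
    by rewrite -(ltr_int R) !intrD -vR -T2 mulr1z; lra.
  by clear -lt5 lt6; lia.
have code_val b p : b \in A -> Posz ((code b).2 p) =
    Posz (b.2 p) - m b.1 p + Posz (2 * Theta).
  move=> /(code_range b p) range; rewrite ffunE inordK; last first.
    by move: range; clear; lia.
  by move: range; clear; lia.
have code_inj : {in A &, injective code}.
  move=> b b' bA b'A bb'; have b1 : b.1 = b'.1 by case: bb'.
  rewrite [b]surjective_pairing [b']surjective_pairing b1; congr (_, _).
  apply/ffunP => p; apply/val_inj => /=.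
  have := code_val b p bA; rewrite bb' code_val// b1.
  by move=> /addIr/addIr[<-].
rewrite -(card_in_imset code_inj) (leq_trans (max_card _))//.
by rewrite card_prod card_ffun card_prod !card_ord card_bool (mulnC k).
Qed.

Local Notation CPk := (CP R k).

Definition cell_of (q : nat) (x : CPk) : cell_type q := cell q (hcoord x).

Lemma cell_of_shrink (U : set CPk) (x : CPk) : open U -> U x ->
  exists q0, forall q, (q0 <= q)%N -> forall y, cell_of q y = cell_of q x -> U y.
Proof.
move=> oU Ux; have [r r0 rP] := open_near oU Ux.
set z := hcoord x in rP *; have z0 : z != 0 by exact: hcoord_neq0.
have n0 : 0 < nrm z by rewrite nrm_gt0.
have B0 : 0 <= 2 * nrm z / r by rewrite !mulr_ge0 ?invr_ge0 ?ltW.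
exists (Num.truncn (2 * nrm z / r)).+1 => q qP y.
have q0 : (0 < q)%N by exact: leq_trans qP.
have w0 := hcoord_neq0 y; set w := hcoord y in w0 *.
rewrite /cell_of -/z -/w => /esym zw.
have [czw le1] := cell_close q0 z0 w0 zw.
pose c := z ord0 (chart z) / w ord0 (chart w).
have c0 : c != 0 by rewrite mulf_neq0 ?invr_eq0 ?chart_neq0.
apply: (rP y c c0).
have -> : c *: w - z = z ord0 (chart z) *: (affine w - affine z).
  by rewrite scalerBr !scalerA divff ?chart_neq0// scale1r.
rewrite nrmZ chartP// (le_lt_trans (ler_wpM2l (ltW n0) le1))//.
rewrite mulrA ltr_pdivrMr ?ltr0n// [ltRHS]mulrC -ltr_pdivrMr// (mulrC (nrm z)).
have := truncn_itv B0 => /andP[_ lt1]; rewrite (lt_le_trans lt1)// ler_nat//.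
Qed.

Lemma open_lt_measurable (P : set 'rV[C]_k.+1) :
  (forall (c : C) z, c != 0 -> P z -> P (c *: z)) ->
  (forall z, z != 0 -> P z ->
    exists2 r : R, 0 < r & forall w, nrm (w - z) < r -> P w) ->
  measurable [set x : CPk | P (hcoord x)].
Proof. by move=> PZ Po; apply: sub_sigma_algebra; exact: open_hcoord. Qed.

Lemma measurable_coord_lt i j :
  measurable [set x : CPk | cabs (hcoord x ord0 i) < cabs (hcoord x ord0 j)].
Proof.
apply: (@open_lt_measurable
  [set z | cabs (z ord0 i) < cabs (z ord0 j)]) => [c z c0|z z0] /=.
  by rewrite !mxE !cabsM ltr_pM2l// cabs_gt0.
move=> lt_ij; exists ((cabs (z ord0 j) - cabs (z ord0 i)) / 2); first lra.
move=> w wz.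
have coord l : cabs (w ord0 l - z ord0 l) <= nrm (w - z).
  by rewrite -row_subE nrm_ge.
have := cabsD (w ord0 i - z ord0 i) (z ord0 i); rewrite subrK.
have := cabsB (w ord0 j) (w ord0 j - z ord0 j); rewrite opprB addrC subrK.
have := coord i; have := coord j; lra.
Qed.

Lemma dominant_fibers : fibers_measurable (fun x : CPk => dominant (hcoord x)).
Proof.
move=> S.
have mD i : measurable [set x : CPk | i \in dominant (hcoord x)].
  have -> : [set x : CPk | i \in dominant (hcoord x)] =
    \bigcap_(j in [set: 'I_k.+1])
      ~` [set x : CPk | cabs (hcoord x ord0 i) < cabs (hcoord x ord0 j)].
    apply/seteqP; split => x /=.
      by rewrite inE => /eqP xi j _ /=; rewrite xi ltNge nrm_ge.
    move=> xi; rewrite inE eq_le nrm_ge nrm_le ?cabs_ge0// => j.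
    by rewrite leNgt; apply/negP; exact: xi.
  by apply: fin_bigcap_measurable => // j _; apply: measurableC;
    exact: measurable_coord_lt.
have -> : (fun x : CPk => dominant (hcoord x)) @^-1` [set S] =
    \bigcap_(i in [set: 'I_k.+1]) [set x : CPk | (i \in dominant (hcoord x)) = (i \in S)].
  apply/seteqP; split => x /=; first by move=> <- i _.
  by move=> xS; apply/setP => i; exact: xS.
apply: fin_bigcap_measurable => // i _; case: (i \in S).
  by have := mD i; congr measurable; apply/seteqP; split.
have := measurableC (mD i); congr measurable; apply/seteqP; split => x /=.
  by move/negP/negbTE.
by move=> ->.
Qed.

(** The cells are Boolean combinations of these sets and of the sets that compare
   two coordinates. *)
Lemma measurable_affine_lt i p (s : R) :
  measurable [set x : CPk |
    hcoord x ord0 i != 0 /\ affine_coord i (hcoord x) p < s].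
Proof.
apply: (@open_lt_measurable
  [set z : 'rV[C]_k.+1 | z ord0 i != 0 /\ affine_coord i z p < s]) => [c z c0|z z0] /=.
  move=> [zi0 lt_s]; rewrite /affine_coord !mxE mulf_neq0//.
  by rewrite -mulf_div divff// mul1r.
move=> [zi0 lt_s]; have zi0' : 0 < cabs (z ord0 i) by rewrite cabs_gt0.
set l := lift i p.1 in lt_s *; set t := affine_coord i z p in lt_s *.
pose K := (cabs (z ord0 i) + cabs (z ord0 l)) / (cabs (z ord0 i) / 2 * cabs (z ord0 i)).
have K0 : 0 < K by rewrite divr_gt0 ?ltr_wpDr ?cabs_ge0// !mulr_gt0.
exists (Num.min (cabs (z ord0 i) / 2) ((s - t) / K)).
  by rewrite lt_min; apply/andP; split; rewrite divr_gt0// subr_gt0.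
move=> w; rewrite lt_min => /andP[wz1 wz2].
have coord m : cabs (w ord0 m - z ord0 m) <= nrm (w - z).
  by rewrite -row_subE nrm_ge.
have wi : cabs (z ord0 i) / 2 <= cabs (w ord0 i).
  have := cabsB (w ord0 i) (w ord0 i - z ord0 i); rewrite opprB addrC subrK.
  have := coord i; lra.
have wi0' : 0 < cabs (w ord0 i) by rewrite (lt_le_trans _ wi)// divr_gt0.
have wi0 : w ord0 i != 0 by rewrite -cabs_gt0.
split=> //; rewrite -(subrK t (affine_coord i w p)) -ltrBrDr.
rewrite (le_lt_trans (ler_norm _))// /t /affine_coord -re_or_imB -/l.
rewrite (le_lt_trans (re_or_im_le _ _))//.
have -> : w ord0 l / w ord0 i - z ord0 l / z ord0 i =
  (z ord0 i * (w ord0 l - z ord0 l) - z ord0 l * (w ord0 i - z ord0 i)) /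
    (w ord0 i * z ord0 i).
  by field; rewrite zi0 wi0.
rewrite cabsM cabsV cabsM ltr_pdivrMr ?mulr_gt0//.
rewrite ltr_pdivlMr// in wz2.
apply: (@le_lt_trans _ _ ((cabs (z ord0 i) + cabs (z ord0 l)) * nrm (w - z))).
  rewrite (le_trans (cabsB _ _))// !cabsM mulrDl.
  by rewrite lerD// ler_wpM2l ?cabs_ge0.
apply: (@lt_le_trans _ _ ((s - t) * (cabs (z ord0 i) / 2 * cabs (z ord0 i)))).
  rewrite -ltr_pdivrMr ?mulr_gt0// ?divr_gt0// mulrAC mulrC//.
by rewrite ler_pM2l ?subr_gt0// ler_pM2r.
Qed.

Lemma cell_of_fibers q : (0 < q)%N -> fibers_measurable (cell_of q).
Proof.
move=> q0 [i phi]; have q0' : 0 < q%:R :> R by rewrite ltr0n.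
pose lt_at p (s : nat) := [set x : CPk |
  hcoord x ord0 i != 0 /\ affine_coord i (hcoord x) p < s%:R / q%:R - 1].
have -> : cell_of q @^-1` [set (i, phi)] =
  [set x | chart (hcoord x) = i] `&` \bigcap_(p in [set: 'I_k * bool])
     (lt_at p (phi p).+1 `\` lt_at p (phi p)).
  apply/seteqP; split => x /=.
    move=> xE; have z0 := hcoord_neq0 x.
    have xi : chart (hcoord x) = i by move: xE; rewrite /cell_of => -[].
    split=> // p _; rewrite /lt_at/= -{1}xi chart_neq0//.
    have := cell_val_itv q p z0; rewrite -/(cell_of q x) xE/= xi.
    rewrite mulrC -ler_pdivrMr// -ltr_pdivlMr// => /andP[le1 lt1].
    split; first by split=> //; lra.
    by move=> [_]; lra.
  move=> [xi xP]; have z0 := hcoord_neq0 x.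
  rewrite /cell_of [LHS]surjective_pairing; congr (_, _) => //.
  apply/ffunP => p; apply/val_inj => /=; rewrite [LHS](cell_val q p z0).
  have [[_ lt1] nlt] := xP p I; rewrite xi; apply: truncn_def.
  rewrite mulrC -ler_pdivrMr// -ltr_pdivlMr//; apply/andP; split; last lra.
  rewrite leNgt; apply/negP => lt2; apply: nlt; split; first by rewrite -xi chart_neq0.
  lra.
apply: measurableI.
  pose pick_chart (S : {set 'I_k.+1}) := odflt ord0 [pick j in S].
  exact: (comp_fibers pick_chart dominant_fibers i).
apply: fin_bigcap_measurable => // p _.
by apply: measurableD; exact: measurable_affine_lt.
Qed.

End Cells.

(** * Two limits of real sequences *)

Section RealLimits.
Variable R : realType.

(** A bound along the multiples of n is enough, since the sequence converges. *)
Lemma cvg_block_le (H : nat -> R) (h a b : R) (n : nat) : (0 < n)%N ->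
  (fun m => H m / m%:R) @ \oo --> h ->
  (forall N, H (n * N.+1)%N <= a + N%:R * b) -> h * n%:R <= b.
Proof.
move=> n0 Hh Hle; have n0' : 0 < n%:R :> R by rewrite ltr0n.
rewrite leNgt; apply/negP => b_lt.
pose del := (h * n%:R - b) / 2; have del0 : 0 < del by rewrite divr_gt0// subr_gt0.
have e0 : 0 < del / n%:R by rewrite divr_gt0.
have /cvgrPdist_lt/(_ _ e0)[N0 _ HN0] := Hh.
pose N1 := (Num.truncn (`|a - b| / del)).+1.
pose N := maxn N0 N1.
have : (N0 <= n * N.+1)%N.
  by rewrite (leq_trans (leq_maxl N0 N1))// (leq_trans (leqnSn N))// leq_pmull.
move=> /HN0/=; set m := (n * N.+1)%N.
have m0 : 0 < m%:R :> R by rewrite ltr0n muln_gt0 n0.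
move=> /ltr_normlW; rewrite ltrBlDr -ltrBlDl ltr_pdivlMr// => lt1.
have := Hle N; rewrite -/m => le1.
have mE : m%:R = n%:R * (N%:R + 1) :> R by rewrite /m natrM -natr1.
have e1 : (h - del / n%:R) * m%:R = (N%:R + 1) * (b + del).
  rewrite mE /del; field; rewrite gt_eqF//.
rewrite e1 in lt1.
have lt2 : `|a - b| < (N%:R + 1) * del.
  have /andP[_ lt3] : (Num.truncn (`|a - b| / del))%:R <= `|a - b| / del < N1%:R.
    by apply: truncn_itv; rewrite divr_ge0// ltW.
  rewrite -ltr_pdivrMr// (lt_le_trans lt3)// natr1 ler_nat leqW//.
  exact: leq_maxr.
have := ler_norm (a - b); nra.
Qed.

Lemma le_of_vanishing_error (h s C D D' : R) (P : nat -> R) :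
  0 <= D -> 0 <= D' ->
  (forall e : R, 0 < e -> exists N, forall n, (N <= n)%N -> P n <= e) ->
  (forall n, (0 < n)%N -> h * n%:R <= C + n%:R * s + P n * (D + n%:R * D')) ->
  h <= s.
Proof.
move=> D0 D'0 P0 hP; rewrite leNgt; apply/negP => sh.
pose eps := h - s; have eps0 : 0 < eps by rewrite subr_gt0.
have DD0 : 0 < D + D' + 1 by rewrite ltr_wpDl ?addr_ge0.
have e0 : 0 < eps / 2 / (D + D' + 1) by rewrite !divr_gt0.
have [N NP] := P0 _ e0.
pose N1 := (Num.truncn (`|C| / (eps / 2))).+1.
pose n := (maxn N N1); have n0 : (0 < n)%N by rewrite leq_max orbT.
have n1 : 1 <= n%:R :> R by rewrite ler1n.
have le1 := hP n n0; have Pn := NP n (leq_maxl _ _).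
have le2 : P n * (D + n%:R * D') <= n%:R * (eps / 2).
  apply: (@le_trans _ _ (eps / 2 / (D + D' + 1) * (n%:R * (D + D' + 1)))).
    apply: (@le_trans _ _ (eps / 2 / (D + D' + 1) * (D + n%:R * D'))).
      by rewrite ler_wpM2r// addr_ge0// mulr_ge0.
    rewrite ler_wpM2l ?(ltW e0)//.
    have : D <= n%:R * D by rewrite ler_peMl.
    lra.
  by rewrite mulrCA divfK// gt_eqF.
have lt3 : `|C| < n%:R * (eps / 2).
  rewrite -ltr_pdivrMr ?divr_gt0//.
  have /andP[_ lt3] : (Num.truncn (`|C| / (eps / 2)))%:R <= `|C| / (eps / 2) < N1%:R.
    by apply: truncn_itv; rewrite divr_ge0// ltW// divr_gt0.
  by rewrite (lt_le_trans lt3)// ler_nat leq_maxr.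
have := ler_norm C; rewrite /eps in le2 lt3; lra.
Qed.

End RealLimits.

(** * Entropy of a partition and stretching of cells *)

Section Ruelle.
Variables (R : realType) (k d : nat) (f : endo (cplx R) k d).
Local Notation C := (cplx R).
Local Notation CPk := (CP R k).
Local Notation F := (endo_lift f).

(** Up to a constant factor, this bounds the norm of the differential of f^n at x
   from above.  The factor nrm (hcoord x) compensates the scaling of the
   representative, as the tangent vector given by e_j at y has norm at most
   1 / |y|. *)
Definition stretch n (x : CPk) : R :=
  \sum_(j < k.+1 | j != chart (hcoord x))
    2 * k.+1%:R * nrm (hcoord x) * diff_iter_norm f n (hcoord x) (delta_mx ord0 j).

Lemma image_sdist n (u : 'rV[C]_k.+1) (x : CPk) :
  sdist u (hcoord (iter n (endo_map f) x)) = sdist u (iter n F (affine (hcoord x))).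
Proof.
have [c c0 ->] := hcoord_iter f n x.
rewrite sdistZr// /affine iter_lift_homogeneous sdistZr//.
by rewrite expf_neq0// invr_eq0 chart_neq0// hcoord_neq0.
Qed.

Lemma image_close n : exists q0, forall q, (q0 <= q)%N -> (0 < q)%N ->
  forall x y : CPk, cell_of q y = cell_of q x ->
  q%:R * sdist (iter n F (affine (hcoord y))) (hcoord (iter n (endo_map f) x)) <=
    4 * stretch n y + 2.
Proof.
have [delta delta0 deltaP] := iter_lift_expansion f n.
exists (Num.truncn (2 / delta)).+1 => q q_big q0 x y xy.
have q0' : 0 < q%:R :> R by rewrite ltr0n.
have y0 := hcoord_neq0 y; have x0 := hcoord_neq0 x.
have [cE le_r] := cell_close q0 y0 x0 xy.
have r_delta : 2 / q%:R <= delta.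
  have /andP[_ lt1] : (Num.truncn (2 / delta))%:R <= 2 / delta < (Num.truncn (2 / delta)).+1%:R.
    by apply: truncn_itv; rewrite divr_ge0// ltW.
  rewrite ler_pdivrMr// mulrC -ler_pdivrMr// ltW// (lt_le_trans lt1)//.
  by rewrite ler_nat.
rewrite image_sdist.
have eq1 : affine (hcoord y) ord0 (chart (hcoord y)) =
    affine (hcoord x) ord0 (chart (hcoord y)).
  by rewrite {2}cE !affine_chart// cE.
have le1 := deltaP _ _ _ _ (nrm_affine y0) (nrm_affine x0) eq1 le_r r_delta.
rewrite mulrC -ler_pdivlMr// (le_trans le1)//.
rewrite mulrA ler_wpM2r ?invr_ge0 ?(ltW q0')//.
set S := \sum_(j < k.+1 | _) _.
have : S <= stretch n y.
  apply: ler_sum => j _; apply: wedge_diff_iter_norm => //.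
  - by rewrite invr_eq0 chart_neq0.
  - exact: nrm_affine.
lra.
Qed.

(** A bound without condition on the differential, exponential in n. *)
Lemma image_far : exists2 M : R, 1 <= M &
  forall n q, (0 < q)%N -> forall x y : CPk, cell_of q y = cell_of q x ->
  q%:R * sdist (iter n F (affine (hcoord y))) (hcoord (iter n (endo_map f) x)) <=
    4 * M ^+ n.
Proof.
have [M M1 MP] := iter_lift_lipschitz f; exists M => // n q q0 x y xy.
have q0' : 0 < q%:R :> R by rewrite ltr0n.
have y0 := hcoord_neq0 y; have x0 := hcoord_neq0 x.
have [_ le_r] := cell_close q0 y0 x0 xy.
have ay : affine (hcoord y) != 0 by rewrite -nrm_gt0 nrm_affine.
have ax : affine (hcoord x) != 0 by rewrite -nrm_gt0 nrm_affine.
rewrite image_sdist mulrC -ler_pdivlMr//.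
have Mn0 : 0 <= M ^+ n by rewrite exprn_ge0// (le_trans _ M1).
rewrite (le_trans (MP n _ _ ay ax))//.
rewrite [leRHS](_ : _ = M ^+ n * (4 / q%:R)); last by ring.
rewrite ler_wpM2l//.
rewrite /sdist !nrm_affine// mulr1 divr1.
rewrite -{1}(subrK (affine (hcoord y)) (affine (hcoord x))) -[X in _ + X]scale1r.
rewrite wedge_addl (le_trans (wedge_le _ _))// nrm_affine// mul1r.
have -> : 4 / q%:R = 2 * (2 / q%:R) :> R by rewrite mulrA -natrM.
by rewrite ler_wpM2l.
Qed.

Lemma card_reach n q (Theta : nat) (y : CPk) (b : cell_type k q) :
  (0 < q)%N -> (2 * Theta <= q)%N ->
  (forall x : CPk, cell_of q x = b ->
     q%:R * sdist (iter n F (affine (hcoord y))) (hcoord (iter n (endo_map f) x)) <=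
     Theta%:R) ->
  (#|reach (endo_map f) n (cell_of q) b| <= k.+1 * (4 * Theta).+1 ^ (2 * k))%N.
Proof.
move=> q0 Tq close.
have u0 : iter n F (affine (hcoord y)) != 0.
  by apply: iter_lift_neq0; rewrite -nrm_gt0 nrm_affine// hcoord_neq0.
have [c c0 cu] := normalize u0.
apply: (card_close_cells q0 Tq cu) => b'; rewrite inE => /asboolP[x [xb xb']].
exists (hcoord (iter n (endo_map f) x)); split; first exact: hcoord_neq0.
- exact: xb'.
- by rewrite sdistZl//; exact: close.
Qed.

Variables (nu : probability CPk R).
Hypothesis nu_inv : invariant_measure nu (endo_map f).

(** Up to an error O(1/n), the entropy of a partition is at most the mean
   logarithmic number of cells that the image under f^n of a cell can meet,
   divided by n.  That number is of order e^(2knt) unless the stretch exceeds e^(nt) on the whole cell. *)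
Lemma partition_entropy_step m (A : 'I_m -> set CPk) (h t : R) : 0 <= t ->
  finite_partition A ->
  (fun n => join_entropy nu (endo_map f) A n / n%:R) @ \oo --> h ->
  exists C D D' : R, [/\ 0 <= D, 0 <= D' &
    forall n, (0 < n)%N -> exists U : set CPk,
      [/\ measurable U, forall x, U x -> ~ stretch n x <= expR (n%:R * t) &
          h * n%:R <= C + n%:R * ((2 * k)%:R * t) +
            fine (nu U) * (D + n%:R * D')]].
Proof.
move=> t0 partA Hh.
have [alpha malpha HE] := partition_index nu (endo_map f) partA.
have mf := endo_map_measurable f.
have [M M1 far] := image_far.
have k2 : 0 <= (2 * k)%:R :> R by [].
exists (ln k.+1%:R + ln 2 + 1 + (2 * k)%:R * ln 29), ((2 * k)%:R * ln 21),
  ((2 * k)%:R * ln M).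
split; rewrite ?mulr_ge0// ?ln_ge0// ?ler1n//.
move=> n n0.
have mX := word_fibers mf (n := n) malpha.
pose J : finType := {ffun 'I_n -> 'I_m}.
have J1 : 1 <= #|J|%:R :> R.
  by rewrite ler1n; apply/card_gt0P; exists (word (endo_map f) alpha n point).
have lnJ : 0 <= ln #|J|%:R :> R by exact: ln_ge0.
(* Names written in full on a set of measure eta cost at most 1 in the mean. *)
pose eta : R := (ln #|J|%:R + 1)^-1.
have eta0 : 0 < eta by rewrite invr_gt0 ltr_wpDl.
pose beta (q : nat) := cell_of (R := R) (k := k) q.+1.
have mbeta q : fibers_measurable (beta q) by exact: cell_of_fibers.
have open_meas (U : set CPk) : open U -> measurable U.
  by move=> oU; exact: sub_sigma_algebra.
have shrink (U : set CPk) (x : CPk) : open U -> U x -> exists q0, forall q,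
    (q0 <= q)%N -> forall y, beta q y = beta q x -> U y.
  move=> oU Ux; have [q0 q0P] := cell_of_shrink oU Ux.
  by exists q0 => q lq; apply: q0P; exact: leqW.
have [q1 q1P] := @cells_approximate_map _ _ _ nu _ beta mbeta (@open CPk) J
  (word (endo_map f) alpha n) eta open_meas shrink mX eta0.
pose E1 := expR (n%:R * t); pose E2 := M ^+ n.
have E1_ge1 : 1 <= E1 by rewrite /E1 -expR0 ler_expR mulr_ge0.
have E2_ge1 : 1 <= E2 by rewrite exprn_ege1.
pose Tg := (Num.truncn (4 * E1 + 2)).+1; pose Tb := (Num.truncn (4 * E2)).+1.
have truncnS_ge (x : R) : 0 <= x -> x <= (Num.truncn x).+1%:R <= x + 1.
  move=> /truncn_itv; rewrite -natr1 => /andP[le1 lt1].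
  by rewrite lerD2r le1 ltW.
have Tg_itv : 4 * E1 + 2 <= Tg%:R <= 4 * E1 + 2 + 1 by apply: truncnS_ge; lra.
have Tb_itv : 4 * E2 <= Tb%:R <= 4 * E2 + 1 by apply: truncnS_ge; lra.
have [q2 close] := image_close n.
(* The cells that meet the image of a cell are counted with Tg if the cell
   contains a point where the stretch is at most E1, and with Tb otherwise. *)
pose q := maxn (maxn q1 q2) (maxn (2 * Tg) (2 * Tb)).
have q1q : (q1 <= q)%N by rewrite /q !leq_max leqnn.
have q2q : (q2 <= q.+1)%N by rewrite leqW// /q !leq_max leqnn orbT.
have Tgq : (2 * Tg <= q.+1)%N by rewrite leqW// /q !leq_max leqnn !orbT.
have Tbq : (2 * Tb <= q.+1)%N by rewrite leqW// /q !leq_max leqnn !orbT.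
have [E [mE ltE EP]] := q1P q q1q.
pose bad (b : cell_type k q.+1) :=
  `[< forall y : CPk, cell_of q.+1 y = b -> ~ stretch n y <= E1 >].
pose c (b : cell_type k q.+1) : R := ln k.+1%:R + (2 * k)%:R *
  (ln (4 * Tg).+1%:R + (bad b)%:R * ln (4 * Tb).+1%:R).
have lnS (N : nat) : 0 <= ln N.+1%:R :> R by rewrite ln_ge0// ler1n.
have reach_c (x : CPk) : ln #|reach (endo_map f) n (beta q) (beta q x)|%:R <=
    c (beta q x).
  have reach0 : (0 < #|reach (endo_map f) n (beta q) (beta q x)|)%N.
    apply/card_gt0P; exists (beta q (iter n (endo_map f) x)).
    by rewrite inE; apply/asboolP; exists x.
  have ln_count (Theta : nat) :
      (#|reach (endo_map f) n (beta q) (beta q x)| <=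
         k.+1 * (4 * Theta).+1 ^ (2 * k))%N ->
      ln #|reach (endo_map f) n (beta q) (beta q x)|%:R <=
        ln k.+1%:R + (2 * k)%:R * ln (4 * Theta).+1%:R :> R.
    move=> le1; rewrite mulr_natl -lnXn ?ltr0n//.
    rewrite -lnM ?posrE ?exprn_gt0 ?ltr0n// -natrX -natrM.
    rewrite ler_ln ?posrE ?ltr0n ?ler_nat// muln_gt0 expn_gt0//.
  have [bx|] := boolP (bad (beta q x)).
    have le1 : (#|reach (endo_map f) n (beta q) (beta q x)| <=
        k.+1 * (4 * Tb).+1 ^ (2 * k))%N.
      apply: (card_reach (y := x)) => // x' xx'.
      by rewrite (le_trans (far n q.+1 _ x' x _))//; case/andP: Tb_itv.
    rewrite (le_trans (ln_count _ le1))// /c bx mul1r lerD2l ler_wpM2l//.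
    by rewrite lerDr.
  move=> nbx; have [y [yx good]] : exists y : CPk,
      cell_of q.+1 y = beta q x /\ stretch n y <= E1.
    apply: contrapT => none; move: nbx; rewrite /bad => /negP; apply.
    by apply/asboolP => y yx good; apply: none; exists y.
  have le1 : (#|reach (endo_map f) n (beta q) (beta q x)| <=
      k.+1 * (4 * Tg).+1 ^ (2 * k))%N.
    apply: (card_reach (y := y)) => // x' xx'.
    rewrite (le_trans (close q.+1 q2q isT x' y _))//; first by rewrite yx.
    by case/andP: Tg_itv => le1 _; lra.
  rewrite (le_trans (ln_count _ le1))// /c lerD2l ler_wpM2l//.
  by rewrite lerDl mulr_ge0.
pose U := beta q @^-1` [set b | bad b].
exists U; split.
- exact: measurable_fibers.
- by move=> x /asboolP; apply.
have block N := @entropy_block _ _ _ nu _ mf nu_inv _ _ n malpha n0 _ _ E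
  (mbeta q) mE EP c N reach_c.
have {block} hb : h * n%:R <= expect nu (beta q) c + ln 2 + ln #|J|%:R * fine (nu E).
  by apply: (cvg_block_le n0 Hh) => N; rewrite HE; exact: block.
apply: (le_trans hb).
have cE : c = fun b => (ln k.+1%:R + (2 * k)%:R * ln (4 * Tg).+1%:R) +
    ((2 * k)%:R * ln (4 * Tb).+1%:R) * (bad b)%:R.
  by apply/funext => b; rewrite /c; ring.
rewrite cE expectD expect_cst// expectZ expect_indicator// -/U.
have P0 : 0 <= fine (nu U) by exact: fine_ge0.
(* 4 Tg + 1 <= 4 (4 E1 + 3) + 1 <= 29 E1 because E1 >= 1, and similarly
   4 Tb + 1 <= 21 E2. *)
have lnE1 : ln (4 * Tg).+1%:R <= ln 29 + n%:R * t.
  rewrite -[n%:R * t]expRK -lnM ?posrE ?expR_gt0// ler_ln ?posrE ?ltr0n//; last first.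
    by rewrite mulr_gt0// expR_gt0.
  by rewrite -natr1 natrM -/E1; lra.
have lnE2 : ln (4 * Tb).+1%:R <= ln 21 + n%:R * ln M.
  have M0 : 0 < M by rewrite (lt_le_trans _ M1).
  rewrite mulr_natl -lnXn// -lnM ?posrE ?exprn_gt0//.
  rewrite ler_ln ?posrE ?ltr0n//; last by rewrite mulr_gt0// exprn_gt0.
  by rewrite -natr1 natrM -/E2; lra.
have lnE : ln #|J|%:R * fine (nu E) <= 1.
  have : fine (nu E) < eta by rewrite -lte_fin fineK// prob_fin_num.
  move=> /ltW/(ler_wpM2l lnJ)/le_trans; apply.
  by rewrite /eta ler_pdivrMr ?ltr_wpDl// mul1r lerDl.
have le1 := ler_wpM2l k2 lnE1.
have le2 := ler_wpM2l P0 (ler_wpM2l k2 lnE2).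
lra.
Qed.

End Ruelle.

(** * The inequality of Ruelle and the largest exponent *)

Section Lyapunov.
Variables (R : realType) (k d : nat) (f : endo (cplx R) k d).
Variable nu : probability (CP R k) R.
Local Notation C := (cplx R).
Local Notation CPk := (CP R k).

Lemma lne_lt_bound (n : nat) (r t : R) : (0 < n)%N ->
  ((n%:R^-1)%:E * lne r%:E < t%:E)%E -> r <= expR (n%:R * t).
Proof.
move=> n0; have n0' : 0 < n%:R :> R by rewrite ltr0n.
have [r0 _|r0] := leP r 0; first by rewrite (le_trans r0)// expR_ge0.
rewrite lne_EFin// -EFinM lte_fin mulrC ltr_pdivrMr// => lt1.
by rewrite -[r in leLHS]lnK ?posrE// ler_expR mulrC ltW.
Qed.

Lemma delta_notin_line (y : 'rV[C]_k.+1) j : y != 0 -> j != chart y ->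
  (delta_mx ord0 j : 'rV[C]_k.+1) \notin <[y]>%VS.
Proof.
move=> y0 jy; apply/negP => /vlineP[a aE].
have /rowP/(_ (chart y)) := aE; rewrite !mxE/= (eq_sym (chart y)) (negbTE jy).
move=> /esym/eqP; rewrite mulf_eq0 (negbTE (chart_neq0 y0)) orbF => /eqP a0.
have /rowP/(_ j) := aE; rewrite a0 scale0r !mxE !eqxx/= => /eqP.
by rewrite oner_eq0.
Qed.

(** At almost every point all directions of an affine chart grow at most at the
   rate of the largest exponent: these directions are transverse to the line of
   the point, so that each of them leaves the flag at some level. *)
Lemma stretch_ae (k_gt0 : (0 < k)%N) (lam : 'I_k -> \bar R) (t : R) :
  lyapunov_exponents f nu lam -> (lam (Ordinal k_gt0) < t%:E)%E ->
  {ae nu, forall x : CPk, exists N, forall n, (N <= n)%N ->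
     stretch f n x <= expR (n%:R * t)}.
Proof.
move=> [lam_mono lam_ae] lam_t.
(* The gap between s and t absorbs the sum over the directions and the norm of
   the representative. *)
have [s lam_s st] : exists2 s : R, (lam (Ordinal k_gt0) < s%:E)%E & s < t.
  case: (lam (Ordinal k_gt0)) lam_t => [r| |]//=.
    rewrite lte_fin => rt; exists ((r + t) / 2); rewrite ?lte_fin; lra.
  by exists (t - 1); rewrite ?ltNyr//; lra.
apply: filterS lam_ae => x [V [dimV subV Vk Vlim]].
set y := hcoord x in Vk Vlim *; have y0 : y != 0 by exact: hcoord_neq0.
have level (w : 'rV[C]_k.+1) : w \notin V k ->
    exists i : 'I_k, w \in V i /\ w \notin V i.+1.
  move=> wk; have w0 : w \in V 0%N.
    have : V 0%N = fullv.
      by apply/eqP; rewrite eqEdim subvf dimvf dimV// subn0 dim_matrix mul1r leqnn.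
    by move=> ->; rewrite memvf.
  have exN : exists i, w \notin V i by exists k.
  case: (ex_minnP exN) => -[|i] wi mini; first by rewrite w0 in wi.
  have ik : (i < k)%N by exact: mini.
  exists (Ordinal ik); split=> //=; apply: contraT => /mini.
  by rewrite ltnn.
have /choice[N NP] : forall j : 'I_k.+1, exists N, forall n, (N <= n)%N ->
    j != chart y -> diff_iter_norm f n y (delta_mx ord0 j) <= expR (n%:R * s).
  move=> j; have [->|jy] := eqVneq j (chart y); first by exists 0%N => n _ /eqP.
  have := delta_notin_line y0 jy; rewrite -Vk => /level[i [wi wi1]].
  have lam_i : (lam i < s%:E)%E.
    by rewrite (le_lt_trans _ lam_s)//; apply: lam_mono.
  have := Vlim i _ wi wi1 => /(_ _ (open_ereal_lt' lam_i))[N _ NP].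
  exists N.+1 => n Nn _; apply: lne_lt_bound; first exact: leq_trans Nn.
  by apply: NP => /=; exact: ltnW.
pose c : R := 2 * k.+1%:R * nrm y.
have c0 : 0 <= c by rewrite !mulr_ge0 ?nrm_ge0.
pose B := k.+1%:R * c; have B0 : 0 <= B by rewrite mulr_ge0.
have ts0 : 0 < t - s by rewrite subr_gt0.
pose N1 := (Num.truncn (B / (t - s))).+1.
exists (maxn N1 (\max_j N j)) => n; rewrite geq_max => /andP[N1n Nn].
apply: (@le_trans _ _ (B * expR (n%:R * s))).
  have -> : B * expR (n%:R * s) = \sum_(j < k.+1) c * expR (n%:R * s).
    by rewrite sumr_const card_ord -[RHS]mulr_natl mulrA.
  rewrite [leRHS](bigID (fun j => j != chart y))/= ler_wpDr//.
    by apply: sumr_ge0 => j _; rewrite mulr_ge0// expR_ge0.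
  apply: ler_sum => j jy; rewrite ler_wpM2l//.
  by apply: NP => //; apply: leq_trans Nn; exact: leq_bigmax.
have -> : n%:R * t = n%:R * (t - s) + n%:R * s by ring.
rewrite expRD ler_wpM2r ?expR_ge0// (le_trans _ (expR_ge1Dx _))//.
apply: (@le_trans _ _ (n%:R * (t - s))); last by rewrite lerDr.
rewrite -ler_pdivrMr// ltW//.
have /andP[_ lt1] : (Num.truncn (B / (t - s)))%:R <= B / (t - s) < N1%:R.
  by apply: truncn_itv; rewrite divr_ge0// ltW.
by rewrite (lt_le_trans lt1)// ler_nat.
Qed.

Hypothesis nu_inv : invariant_measure nu (endo_map f).

(** The inequality of Ruelle, with the sum of the positive exponents replaced by k
   times a bound for the largest one.  The cells without a point of moderate
   stretch have total measure tending to 0, because almost every point belongs to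
   finitely many of their unions. *)
Lemma partition_entropy_le (k_gt0 : (0 < k)%N) (lam : 'I_k -> \bar R) (t : R)
    m (A : 'I_m -> set CPk) :
  lyapunov_exponents f nu lam -> (lam (Ordinal k_gt0) < t%:E)%E -> 0 <= t ->
  finite_partition A ->
  partition_entropy nu (endo_map f) A <= (2 * k)%:R * t.
Proof.
move=> nu_lam lam_t t0 partA; rewrite /partition_entropy.
set u := fun n => _; have kt0 : 0 <= (2 * k)%:R * t by rewrite mulr_ge0.
(* A divergent sequence has limit 0 by convention. *)
have [cvgu|dvgu] := pselect (cvg (u @ \oo)); last by rewrite (dvgP dvgu).
have [K [D [D' [D0 D'0 stepP]]]] := partition_entropy_step nu_inv t0 partA cvgu.
have /choice[U UP] : forall n, exists U : set CPk,
    [/\ measurable U, forall x, U x -> ~ stretch f n x <= expR (n%:R * t) &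
        (0 < n)%N -> limn u * n%:R <= K + n%:R * ((2 * k)%:R * t) +
            fine (nu U) * (D + n%:R * D')].
  case=> [|n]; first by exists set0; split.
  by have [U [mU Ustretch Ule]] := stepP n.+1 isT; exists U.
apply: (@le_of_vanishing_error _ _ _ K D D' (fun n => fine (nu (U n)))) => //.
  move=> e e0; pose V N := \bigcup_(n in [set n | (N <= n)%N]) U n.
  have mU n : measurable (U n) by have [] := UP n.
  have mV N : measurable (V N) by exact: bigcup_measurable.
  have nuV0 : nu (\bigcap_N V N) = 0%E.
    have : nu.-negligible (\bigcap_N V N).
      apply: negligibleS (stretch_ae nu_lam lam_t) => x Vx [N NP].
      by have [n /= Nn Ux] := Vx N I; have [_ /(_ x Ux) nle _] := UP n; exact/nle/NP.
    by move/(negligibleP _ (bigcapT_measurable mV)).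
  have [|N NP] := vanishing_prob mV _ nuV0 e0.
    by move=> i j ij x [n /= jn Ux]; exists n => //=; exact: leq_trans jn.
  exists N => n Nn; rewrite -lee_fin fineK ?prob_fin_num// ltW//.
  apply: le_lt_trans (NP N (leqnn N)); apply: le_measure; rewrite ?inE//.
  by move=> x Ux; exists n.
by move=> n n0; have [_ _] := UP n; exact.
Qed.

End Lyapunov.

Theorem corollaryC (R : realType) (k : nat) (k_gt0 : (0 < k)%N)
    (d : nat) (d_ge2 : (2 <= d)%N) (f : endo (cplx R) k d)
    (nu : probability (CP R k) R)
    (nu_inv : invariant_measure nu (endo_map f))
    (nu_erg : ergodic_measure nu (endo_map f))
    (lam : 'I_k -> \bar R) (nu_lam : lyapunov_exponents f nu lam) :
  let h : \bar R := metric_entropy nu (endo_map f) in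
  let lam1 : \bar R := lam (Ordinal k_gt0) in
  let L : R := ln (d%:R ^+ k.-1) in
  let phi : \bar R -> \bar R := fun t =>
    ((2^-1)%:E * (((1 + k%:R^-1) * L)%:E - t))%E in
  ((L%:E < h)%E ->
     (((1 - k%:R^-1) * ln (Num.sqrt d%:R))%:E <= lam1)%E) /\
  ((L%:E < h)%E -> (h < ((1 + k%:R^-1) * L)%:E)%E ->
     (0 < phi h)%E /\
     ((2^-1)%:E * (h - L%:E) + phi h <= lam1)%E).
Proof.
move=> h lam1 L phi.
have k0 : 0 < k%:R :> R by rewrite ltr0n.
have d1 : 1 < d%:R :> R by rewrite ltr1n.
have d0 : 0 < d%:R :> R by rewrite (lt_trans _ d1).
have LE : L = (k%:R - 1) * ln d%:R.
  by rewrite /L lnXn// -[LHS]mulr_natl -subn1 natrB.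
set t := (1 - k%:R^-1) * ln (Num.sqrt d%:R).
have tE : t = L / (2 * k%:R).
  have sqrt0 : 0 < Num.sqrt d%:R :> R by rewrite sqrtr_gt0.
  have ln_d : ln d%:R = 2 * ln (Num.sqrt d%:R) :> R.
    by rewrite -[in LHS](@sqr_sqrtr _ d%:R) ?ltW// lnXn// mulr_natl.
  by rewrite /t LE ln_d; field; rewrite gt_eqF.
have t0 : 0 <= t.
  by rewrite tE divr_ge0 ?mulr_ge0 ?(ltW k0)// ln_ge0// exprn_ege1// ltW.
have part1 : (L%:E < h)%E -> (t%:E <= lam1)%E.
  move=> Lh; rewrite leNgt; apply/negP => lam_t; move: Lh; apply/negP; rewrite -leNgt.
  apply: ge_ereal_sup => _ [m [A [partA ->]]]; rewrite lee_fin.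
  rewrite (le_trans (partition_entropy_le nu_inv nu_lam lam_t t0 partA))//.
  by rewrite tE natrM mulrC divfK// mulf_neq0// gt_eqF.
split=> // Lh hL.
have t_lam := part1 Lh.
have hfin : h \is a fin_num.
  by rewrite fin_real// (lt_trans (ltNyr L) Lh) (lt_trans hL (ltry _)).
rewrite -(fineK hfin) in Lh hL *; rewrite !lte_fin in Lh hL.
split; first by rewrite /phi -EFinB -EFinM lte_fin mulr_gt0// subr_gt0.
apply: le_trans t_lam; rewrite /phi -!EFinB -!EFinM -EFinD lee_fin.
rewrite le_eqVlt; apply/orP; left; apply/eqP.
by rewrite tE; field; rewrite gt_eqF.
Qed.
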